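(* Let $W\subseteq J^r(S^n,\mathbb{R}^m)$ be a singularity type. There exists a constant $c_1>0$ (depending on $W$) such that for every degree pattern $\underline d=(d_1,\ldots,d_m)$ with $d_1,\ldots,d_m\ge r+1$ and every $P\in\mathcal{P}_{n,\underline d}$ with $P\notin\Sigma_{W,\underline d}$, writing $p=P|_{S^n}$, one has $$\{f\in C^{r+1}(S^n,\mathbb{R}^m)\mid \|f-p\|_{C^{r+1}}<c_1\,\mathrm{dist}_{\mathrm{BW}}(P,\Sigma_{W,\underline d})\}\subseteq \mathrm{SN}(p,W).$$
   Context: $S^n\subset\mathbb{R}^{n+1}$ is the unit sphere; $J^r(S^n,\mathbb{R}^m)$ is the manifold of $r$-jets with its natural real algebraic structure, $j^rf:S^n\to J^r(S^n,\mathbb{R}^m)$ the jet prolongation of $f$. Singularity type: a semialgebraic subset $W\subseteq J^r(S^n,\mathbb{R}^m)$ invariant under the diffeomorphisms induced by orthogonal changes of variables (the action of $O(n+1)$ on the source). Transversality: a semialgebraic stratification $W=\coprod_{i=1}^kW_i$ into smooth semialgebraic strata is fixed. For $f\in C^{r+1}(S^n,\mathbb{R}^m)$, $j^rf$ is transversal to $W$ (written $j^rf\pitchfork W$) if for every $i$ and every $x\in S^n$ either $j^rf(x)\notin W_i$, or $j^rf(x)\in W_i$ and $d_x(j^rf)(T_xS^n)+T_{j^rf(x)}W_i=T_{j^rf(x)}J^r(S^n,\mathbb{R}^m)$. Stable neighborhood: for $f\in C^{r+1}(S^n,\mathbb{R}^m)$ with $j^rf\pitchfork W$, $\mathrm{SN}(f,W)$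 is the set of $g\in C^{r+1}(S^n,\mathbb{R}^m)$ for which there is a homotopy $f_t$, $t\in[0,1]$, in $C^{r+1}(S^n,\mathbb{R}^m)$ with $f_0=f$, $f_1=g$ and $j^rf_t\pitchfork W$ for all $t\in[0,1]$. Polynomials: $\mathcal{P}_{n,d}$ is the space of real homogeneous polynomials of degree $d$ in $x_0,\ldots,x_n$ and $\mathcal{P}_{n,\underline d}=\prod_i\mathcal{P}_{n,d_i}$. The discriminant is $\Sigma_{W,\underline d}=\{P\in\mathcal{P}_{n,\underline d}\mid j^r(P|_{S^n})\text{ is not transversal to }W\}$. Bombieri–Weyl norm: for $P=\sum_{|\alpha|=d}a_\alpha\sqrt{\tfrac{d!}{\alpha_0!\cdots\alpha_n!}}\,x^\alpha\in\mathcal{P}_{n,d}$, $\|P\|_{\mathrm{BW}}^2=\sum_\alpha a_\alpha^2$; for a system, $\|P\|_{\mathrm{BW}}^2=\sum_i\|P_i\|_{\mathrm{BW}}^2$. $\mathrm{dist}_{\mathrm{BW}}$ is the associated distance (within $\mathcal{P}_{n,\underline d}$). $C^k$-norm (used with $k=r+1$): fix an $O(n+1)$-invariant norm $\nu$ on the finite-dimensional space of lists of all derivatives of order $\le k$ of maps $\mathbb{R}^{n+1}\to\mathbb{R}^m$ at a point, i.e. on the fiber of $J^k(\mathbb{R}^{n+1},\mathbb{R}^m)\to\mathbb{R}^{n+1}$; for a jet $z$, $\nu(z)$ is the norm of its fiber component. Let $\rho:J^k(\mathbb{R}^{n+1},\mathbb{R}^m)|_{S^n}\to J^k(S^n,\mathbb{R}^m)$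 be the restriction map, sending the $k$-jet at $x\in S^n$ of a map $F$ to the $k$-jet of $F|_{S^n}$ at $x$. For $\eta\in J^k_x(S^n,\mathbb{R}^m)$ put $\hat\nu(\eta)=\inf\{\nu(z): z\in J^k_x(\mathbb{R}^{n+1},\mathbb{R}^m),\ \rho(z)=\eta\}$, and $\|f\|_{C^k}=\|f\|_{C^k}^\nu=\sup_{x\in S^n}\hat\nu(j^kf(x))$. The choice of $\nu$ is fixed throughout. *)

(* Defs.v *)
(* multinomials' notations clash with those of MathComp-Analysis. *)
From mathcomp Require Export all_boot all_order all_algebra.
From mathcomp Require Export all_classical all_reals all_analysis.
From mathcomp Require Export -(notations) mpoly.

Set Implicit Arguments.
Unset Strict Implicit.
Unset Printing Implicit Defensive.

Import Order.TTheory GRing.Theory Num.Theory.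
Import numFieldNormedType.Exports.

Local Open Scope classical_set_scope.
Local Open Scope ring_scope.

Section Calculus.
Context {R : realType}.

(* F has continuous iterated directional derivatives up to order k on U; on a
   finite-dimensional V this is the usual C^k (partial derivatives of order
   <= k exist and are continuous). *)
Fixpoint Ck_on {V V' : normedModType R} (k : nat) (U : set V) (F : V -> V')
    : Prop :=
  (forall x, U x -> {for x, continuous F}) /\
  if k is k'.+1 then
    (forall v x, U x -> derivable F x v) /\
    (forall v, Ck_on k' U (fun x => 'D_v F x))
  else True.

(* Velocities at p of the curves through p in M; this is the tangent space
   T_pM when M is an embedded submanifold of a finite-dimensional V. *)
Definition tangent {V : normedModType R} (M : set V) (p : V) : set V :=
  [set v | exists g : R -> V,
     [/\ g 0 = p, \forall t \near (0 : R), M (g t) & is_derive (0 : R) 1 g v]].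

(* Embedded C^oo submanifold (not necessarily closed) of codimension c. *)
Definition smooth_submanifold {V : normedModType R} (c : nat) (M : set V)
    : Prop :=
  forall p, M p -> exists (U : set V) (h : V -> 'rV[R]_c),
    [/\ open U, U p, forall k, Ck_on k U h,
        range ('d h p) = setT & M `&` U = U `&` h @^-1` [set 0]].

Inductive semialgebraic (q : nat) : set 'rV[R]_q -> Prop :=
| semialgebraic_gt0 (p : mpoly q R) :
    semialgebraic [set x | 0 < meval (x 0) p]
| semialgebraicU A B :
    semialgebraic A -> semialgebraic B -> semialgebraic (A `|` B)
| semialgebraicI A B :
    semialgebraic A -> semialgebraic B -> semialgebraic (A `&` B)
| semialgebraicC A : semialgebraic A -> semialgebraic (~` A).

Definition orthogonal_mx {N : nat} (g : 'M[R]_N) : Prop := g *m g^T = 1%:M.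

Definition is_norm {V : lmodType R} (nu : V -> R) : Prop :=
  [/\ forall z w, nu (z + w) <= nu z + nu w,
      forall a z, nu (a *: z) = `|a| * nu z
    & forall z, nu z = 0 -> z = 0].

(* The fiber of J^k(R^N, R^m) -> R^N: one row (a vector of R^m) for each
   multi-index of degree <= k. *)
Definition jet_fiber (N m k : nat) : normedModType R :=
  'M[R]_(#|{: bmultinom N k.+1}|, m).

Definition partial {N m : nat} (a : multinom N) (F : 'rV[R]_N -> 'rV[R]_m) :
    'rV[R]_N -> 'rV[R]_m :=
  foldr (fun i G => iter (a i) (fun H x => 'D_(delta_mx 0 i) H x) G)
    F (enum 'I_N).

Definition derivatives {N m : nat} (k : nat) (F : 'rV[R]_N -> 'rV[R]_m)
    (x : 'rV[R]_N) : jet_fiber N m k :=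
  \matrix_(a < #|{: bmultinom N k.+1}|) partial (enum_val a) F x.

(* The polynomial map of degree <= k whose list of derivatives at 0 is z. *)
Definition taylor {N m k : nat} (z : jet_fiber N m k) (v : 'rV[R]_N)
    : 'rV[R]_m :=
  \sum_(a < #|{: bmultinom N k.+1}|)
    ((\prod_(i < N) v 0 i ^+ (enum_val a : multinom N) i) /
     (\prod_(i < N) ((enum_val a : multinom N) i)`!)%:R) *: row a z.

(* If z is the jet of F at x, then fiber_act g z is the jet of
   y |-> F (y *m g^-1) at x *m g (orthogonal g, so g^-1 = g^T). *)
Definition fiber_act {N m k : nat} (g : 'M[R]_N) (z : jet_fiber N m k)
    : jet_fiber N m k :=
  derivatives k (fun v => taylor z (v *m g^T)) 0.

End Calculus.
Arguments jet_fiber R N m k : clear implicits.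

Section Sphere.
Context {R : realType}.

(* The norm of the normed module 'rV[R]_N is the sup norm, hence this one. *)
Definition enorm {N : nat} (x : 'rV[R]_N) : R :=
  Num.sqrt (\sum_(i < N) x 0 i ^+ 2).

Definition sphere (n : nat) : Type := {x : 'rV[R]_n.+1 | enorm x == 1}.

Lemma sphere_base_subproof (n : nat) :
  enorm (delta_mx 0 0 : 'rV[R]_n.+1) == 1.
Proof.
rewrite /enorm (bigD1 ord0) //= mxE !eqxx expr1n big1 ?addr0 ?sqrtr1 //.
by move=> i i0; rewrite mxE (negbTE i0) andbF expr0n.
Qed.

Definition sphere_base (n : nat) : sphere n :=
  exist _ (delta_mx 0 0) (sphere_base_subproof n).

(* y / |y|; the value at y = 0 is irrelevant. *)
Definition sphere_proj {n : nat} (y : 'rV[R]_n.+1) : sphere n :=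
  insubd (sphere_base n) ((enorm y)^-1 *: y).

Definition radial_ext {n : nat} {V : Type} (f : sphere n -> V)
    (y : 'rV[R]_n.+1) : V :=
  f (sphere_proj y).

(* Since (x, t) |-> t x is a diffeomorphism from S^n x ]0, +oo[ onto
   R^(n+1) \ {0}, f is C^k on S^n iff its radial extension is C^k there. *)
Definition Ck_sphere {n m : nat} (k : nat) (f : sphere n -> 'rV[R]_m) : Prop :=
  Ck_on k [set y | y != 0] (radial_ext f).

(* J^k(S^n, R^m) is realized inside J^k(R^(n+1), R^m) = R^(n+1) x jet_fiber:
   the k-jet at x of f : S^n -> R^m is represented by the k-jet at x of the
   radial extension of f. On S^n the derivatives of y |-> y / |y| are
   polynomials in the point, so the image is a closed real algebraic
   submanifold (a vector bundle over S^n) carrying the natural real algebraic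
   structure of J^k(S^n, R^m); y |-> y / |y| being O(n+1)-equivariant, O(n+1)
   acts on it by the restriction of its action on J^k(R^(n+1), R^m). *)
Definition jet_ambient (n m k : nat) : normedModType R :=
  ('rV[R]_n.+1 * jet_fiber R n.+1 m k)%type.

Definition jet {n m : nat} (k : nat) (f : sphere n -> 'rV[R]_m) (x : sphere n)
    : jet_ambient n m k :=
  (val x, derivatives k (radial_ext f) (val x)).

Definition jet_space (n m k : nat) : set (jet_ambient n m k) :=
  [set w | exists (f : sphere n -> 'rV[R]_m) (x : sphere n),
     Ck_sphere k f /\ w = jet k f x].
Arguments jet_space : clear implicits.

(* The restriction map rho, on the fiber at x: z is the jet at x of the map
   y |-> taylor z (y - x), which is then restricted to S^n. *)
Definition jet_restr {n m k : nat} (x : sphere n)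
    (z : jet_fiber R n.+1 m k) : jet_ambient n m k :=
  jet k (fun s : sphere n => taylor z (val s - val x)) x.

Definition quotient_norm {n m k : nat} (nu : jet_fiber R n.+1 m k -> R)
    (x : sphere n) (eta : jet_ambient n m k) : \bar R :=
  ereal_inf [set (nu z)%:E | z in [set z | jet_restr x z = eta]].

Definition Ck_norm {n m k : nat} (nu : jet_fiber R n.+1 m k -> R)
    (f : sphere n -> 'rV[R]_m) : \bar R :=
  ereal_sup [set quotient_norm nu x (jet k f x) | x in [set: sphere n]].

Definition jet_coords {n m k : nat} (w : jet_ambient n m k) :
    'rV[R]_(n.+1 + #|{: bmultinom n.+1 k.+1}| * m) :=
  row_mx w.1 (mxvec (w.2 : 'M[R]_(_, m))).

Definition jet_semialgebraic {n m k : nat} (W : set (jet_ambient n m k))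
    : Prop :=
  semialgebraic [set jet_coords w | w in W].

Definition jet_act {n m k : nat} (g : 'M[R]_n.+1) (w : jet_ambient n m k)
    : jet_ambient n m k :=
  (w.1 *m g, fiber_act g w.2).

Definition singularity_type {n m r : nat} (W : set (jet_ambient n m r))
    : Prop :=
  [/\ W `<=` jet_space n m r, jet_semialgebraic W
    & forall g, orthogonal_mx g -> forall w, W w -> W (jet_act g w)].

Definition smooth_stratification {n m r : nat} (W : set (jet_ambient n m r))
    (k : nat) (S : 'I_k -> set (jet_ambient n m r)) : Prop :=
  [/\ W = \bigcup_i S i, trivIset setT S, forall i, jet_semialgebraic (S i)
    & forall i, exists c, smooth_submanifold c (S i)].

(* The differential at x of j^r f : S^n -> J^r(S^n, R^m) is the restriction
   to T_xS^n of the differential of its radial extension. *)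
Definition transversal {n m r k : nat} (f : sphere n -> 'rV[R]_m)
    (S : 'I_k -> set (jet_ambient n m r)) : Prop :=
  forall (i : 'I_k) (x : sphere n),
    ~ S i (jet r f x) \/
    S i (jet r f x) /\
    [set u + v |
       u in 'd (radial_ext (jet r f)) (val x) @`
              tangent [set y | enorm y = 1] (val x)
     & v in tangent (S i) (jet r f x)]
    = tangent (jet_space n m r) (jet r f x).

(* Homotopies are continuous paths for the C^(r+1)-topology; nu enters only
   through that topology. *)
Definition stable_nbhd {n m r k : nat} (nu : jet_fiber R n.+1 m r.+1 -> R)
    (f : sphere n -> 'rV[R]_m) (S : 'I_k -> set (jet_ambient n m r)) :
    set (sphere n -> 'rV[R]_m) :=
  [set g | Ck_sphere r.+1 g /\
     exists h : R -> sphere n -> 'rV[R]_m,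
       [/\ h 0 = f, h 1 = g,
           forall t : R, 0 <= t <= 1 -> Ck_sphere r.+1 (h t),
           forall t : R, 0 <= t <= 1 -> forall e : R, 0 < e ->
             \forall s \near t, 0 <= s <= 1 ->
               (Ck_norm nu (h s \- h t)%R < e%:E)%E
         & forall t : R, 0 <= t <= 1 -> transversal (h t) S]].

Definition hpoly_sys (n m : nat) (d : 'I_m -> nat)
    : set ('I_m -> mpoly n.+1 R) :=
  [set P | forall i, P i \is ishomog1 (d i) mdeg].

Definition sphere_restr {n m : nat} (P : 'I_m -> mpoly n.+1 R) (x : sphere n)
    : 'rV[R]_m :=
  \row_(i < m) meval (val x 0) (P i).

Definition discriminant {n m r k : nat} (S : 'I_k -> set (jet_ambient n m r))
    (d : 'I_m -> nat) : set ('I_m -> mpoly n.+1 R) :=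
  [set P | hpoly_sys d P /\ ~ transversal (sphere_restr P) S].

(* Coordinate of P on sqrt (d! / (a_0! ... a_n!)) x^a. *)
Definition bw_coef {N : nat} (d : nat) (P : mpoly N R) (a : multinom N) : R :=
  mcoeff a P / Num.sqrt (d`!%:R / (\prod_(i < N) (a i)`!)%:R).

Definition bw_norm {n m : nat} (d : 'I_m -> nat) (P : 'I_m -> mpoly n.+1 R)
    : R :=
  Num.sqrt (\sum_(i < m)
    \sum_(a : bmultinom n.+1 (d i).+1 | mdeg a == d i)
      bw_coef (d i) (P i) a ^+ 2).

(* +oo when A is empty. *)
Definition bw_dist {n m : nat} (d : 'I_m -> nat) (P : 'I_m -> mpoly n.+1 R)
    (A : set ('I_m -> mpoly n.+1 R)) : \bar R :=
  ereal_inf [set (bw_norm d (fun i => P i - Q i))%:E | Q in A].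

End Sphere.
Arguments sphere R n : clear implicits.
Arguments jet_ambient R n m k : clear implicits.
Arguments hpoly_sys R n m d : clear implicits.
Arguments jet_space R n m k : clear implicits.

(* Main.v *)
(* Join p = P|_S to f by the segment h_t = p + t (f - p).  Transversality at x
   depends only on the (r+1)-jet at x, so if h_t fails to be transversal at x,
   then so does (P + t Q)|_S for every homogeneous system Q of degree d such
   that Q|_S and f - p have the same (r+1)-jet at x.  Hence P + t Q lies in the
   discriminant and dist_BW(P, Sigma) <= ||Q||_BW; it remains to find such a Q
   with ||Q||_BW <= K nu(z), where z lifts the jet of f - p and K does not
   depend on d.
   For unit x put l = <x, y> and u_j = y_j - x_j l.  The jet is a combination of
   the l^k u^b, and since l^2 + |u|^2 = 1 on the sphere, l^k u^b agrees there to
   high order with the homogeneous polynomial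
     sum_{j <= J} c_j l^(d-|b|-2j) |u|^(2j) u^b,
   the c_j being binomial coefficients of size O(d^j).  As u^b |u|^(2j) does not
   involve l, the squared Bombieri-Weyl norm of its product with l^(d-t),
   t = |b| + 2j, is divided by the binomial (d choose t); this is of order
   d^(-t) and compensates the growth of c_j^2. *)

(* The difficulty is uniformity in d; everything below is arranged so that no constant sees d. The
   order of contact is what keeps the degrees low: on the sphere 1 - l = |y - x|^2 / 2 vanishes to
   order 2 at x, so an error containing (l - 1)^(J+1) u^b vanishes to order 2J + 2 + |b|. With J
   maximal such that 2J + |b| <= r + 1, this order is at least r + 2, and every exponent d - |b| -
   2j is nonnegative because d >= r + 1. The same inequality bounds all exponents t = |b| + 2j by r
   + 1, so quantities such as t^t and t! are bounded in terms of r alone. The c_j are the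
   coefficients of a truncated expansion of l^(k-e), e = d - |b|, in powers of |u|^2 / l^2. Norms
   are computed with the Fischer product, d! times the Bombieri-Weyl product in degree d:
   multiplication by l is adjoint to the derivative along x, and that derivative kills every u_j. *)
From HB Require Import structures.
From mathcomp Require Import ring lra zify.
Require Import Defs.
Import Order.TTheory GRing.Theory Num.Theory.
Import numFieldNormedType.Exports.

Set Implicit Arguments.
Unset Strict Implicit.
Unset Printing Implicit Defensive.

Local Open Scope classical_set_scope.
Local Open Scope ring_scope.

(** * Calculus of class C^k *)

Section CkOn.
Context {R : realType} {V V' : normedModType R}.
Implicit Types (F G : V -> V') (U : set V).

Lemma Ck_on_cont k U F x : Ck_on k U F -> U x -> {for x, continuous F}.
Proof. by case: k => [|k] [cF _]; exact: cF. Qed.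

Lemma Ck_on_derivable k U F x v : Ck_on k.+1 U F -> U x -> derivable F x v.
Proof. by case=> _ [dF _]; exact: dF. Qed.

Lemma Ck_on_derive k U F v : Ck_on k.+1 U F -> Ck_on k U ('D_v F).
Proof. by case=> _ [_]; exact. Qed.

Lemma Ck_on_pred k U F : Ck_on k.+1 U F -> Ck_on k U F.
Proof.
elim: k F => [|k IH] F [cF [dF DF]]; first by split.
by split => //; split => // v; apply: IH; exact: DF.
Qed.

Lemma Ck_on_leq j k U F : (j <= k)%N -> Ck_on k U F -> Ck_on j U F.
Proof.
by move=> /subnK <-; elim: (k - j)%N => [//|i IH] /Ck_on_pred; exact: IH.
Qed.

Lemma near_open_eq U F G x : open U -> {in U, F =1 G} -> U x ->
  \near x, F x = G x.
Proof.
move=> oU FG Ux; have : nbhs x U by exact: open_nbhs_nbhs.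
by apply: filterS => y Uy; apply: FG; rewrite inE.
Qed.

Lemma derive_eq_on U F G v : open U -> {in U, F =1 G} ->
  {in U, 'D_v F =1 'D_v G}.
Proof.
move=> oU FG x; rewrite inE => Ux.
by apply: near_eq_derive; exact: near_open_eq oU FG Ux.
Qed.

Lemma Ck_on_eq k U F G : open U -> {in U, F =1 G} -> Ck_on k U F -> Ck_on k U G.
Proof.
move=> oU; elim: k F G => [|k IH] F G FG [cF dF].
- split => // x Ux.
  rewrite /prop_for /continuous_at -(FG x) ?inE//.
  by apply: cvg_trans (cF x Ux); apply: near_eq_cvg; exact: near_open_eq Ux.
- split.
    move=> x Ux; rewrite /prop_for /continuous_at -(FG x) ?inE//.
    by apply: cvg_trans (cF x Ux); apply: near_eq_cvg; exact: near_open_eq Ux.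
  case: dF => dF DF; split.
    move=> v x Ux; apply: near_eq_derivable (dF v x Ux).
    exact: near_open_eq Ux.
  by move=> v; apply: (IH ('D_v F)); [exact: derive_eq_on|exact: DF].
Qed.

Lemma Ck_onD k U F G : open U -> Ck_on k U F -> Ck_on k U G ->
  Ck_on k U (F + G).
Proof.
move=> oU; elim: k F G => [|k IH] F G hF hG.
  by split => // x Ux; apply: continuousD; [exact: (Ck_on_cont hF)|exact: (Ck_on_cont hG)].
split; [|split].
- by move=> x Ux; apply: continuousD; [exact: (Ck_on_cont hF)|exact: (Ck_on_cont hG)].
- by move=> v x Ux; exact: derivableD (Ck_on_derivable hF Ux) (Ck_on_derivable hG Ux).
move=> v; apply: (@Ck_on_eq k U ('D_v F + 'D_v G)) => //.
  move=> x; rewrite inE => Ux.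
  by rewrite (deriveD (Ck_on_derivable hF Ux) (Ck_on_derivable hG Ux)).
by apply: IH; exact: Ck_on_derive.
Qed.

Lemma Ck_onZ k U F (c : R) : open U -> Ck_on k U F -> Ck_on k U (c *: F).
Proof.
move=> oU; elim: k F => [|k IH] F hF.
  by split => // x Ux; apply: cvgZl_tmp; exact: (Ck_on_cont hF).
split; [|split].
- by move=> x Ux; apply: cvgZl_tmp; exact: (Ck_on_cont hF).
- by move=> v x Ux; exact: derivableZ (Ck_on_derivable hF Ux).
move=> v; apply: (@Ck_on_eq k U (c *: 'D_v F)) => //.
  move=> x; rewrite inE => Ux.
  by rewrite (deriveZ _ (Ck_on_derivable hF Ux)).
by apply: IH; exact: Ck_on_derive.
Qed.

Lemma Ck_on_cst k U (c : V') : open U -> Ck_on k U (cst c).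
Proof.
move=> oU; elim: k c => [|k IH] c; first by split => // x _; exact: cvg_cst.
split; [by move=> x _; exact: cvg_cst|split].
  by move=> v x _; exact: derivable_cst.
move=> v; apply: (@Ck_on_eq k U (cst 0)) => //.
by move=> x _; rewrite derive_cst.
Qed.

End CkOn.

Section CkOnScalar.
Context {R : realType} {V : normedModType R}.
Implicit Types (F G : V -> R) (U : set V).

Lemma Ck_onM k U F G : open U -> Ck_on k U F -> Ck_on k U G ->
  Ck_on k U (F * G).
Proof.
move=> oU; elim: k F G => [|k IH] F G hF hG.
  by split => // x Ux; apply: continuousM; [exact: (Ck_on_cont hF)|exact: (Ck_on_cont hG)].
split; [|split].
- by move=> x Ux; apply: continuousM; [exact: (Ck_on_cont hF)|exact: (Ck_on_cont hG)].
- by move=> v x Ux; exact: derivableM (Ck_on_derivable hF Ux) (Ck_on_derivable hG Ux).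
move=> v; apply: (@Ck_on_eq _ _ _ k U (F * 'D_v G + G * 'D_v F)) => //.
  move=> x; rewrite inE => Ux.
  by rewrite (deriveM (Ck_on_derivable hF Ux) (Ck_on_derivable hG Ux)).
by apply: Ck_onD => //; apply: IH; (exact: Ck_on_derive || exact: Ck_on_pred).
Qed.

Lemma continuous_mxP p q (F : V -> 'M[R]_(p, q)) x :
  {for x, continuous F} <->
  forall i j, {for x, continuous (fun y => F y i j)}.
Proof.
split=> [cF i j|cF].
  apply: (@continuous_comp _ _ _ F (fun M : 'M[R]_(p, q) => M i j)) => //.
  exact: coord_continuous.
apply/cvgrPdist_lt => e e0; near=> y.
rewrite /Num.Def.normr/= mx_normrE (bigmax_lt _ e0)//= => i _.
rewrite !mxE/=; move: i; near: y; apply: filter_forall => /= i.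
exact: ((cvgrPdist_lt _ _).1 (cF i.1 i.2)).
Unshelve. all: by end_near. Qed.

Lemma Ck_on_mxP k U p q (F : V -> 'M[R]_(p, q)) : open U ->
  Ck_on k U F <-> forall i j, Ck_on k U (fun x => F x i j).
Proof.
move=> oU; elim: k F => [|k IH] F.
  split=> [[cF _] i j|cF]; split => // x Ux.
    by have /continuous_mxP := cF x Ux.
  by apply/continuous_mxP => i j; exact: (Ck_on_cont (cF i j)).
have DE v i j : (forall x, U x -> derivable F x v) ->
    {in U, (fun x => 'D_v F x i j) =1 'D_v (fun x => F x i j)}.
  by move=> dF x; rewrite inE => Ux; rewrite derive_mx ?mxE//; exact: dF.
split=> [[cF [dF DF]] i j|hF].
  split; [|split].
  - by move=> x Ux; have /continuous_mxP := cF x Ux.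
  - by move=> v x Ux; have /derivable_mxP := dF v x Ux.
  move=> v; apply: (Ck_on_eq oU (DE v i j (dF v))).
  by move: i j; apply/IH; exact: DF.
have dF v x : U x -> derivable F x v.
  by move=> Ux; apply/derivable_mxP => i j; exact: Ck_on_derivable Ux.
split; [|split] => //.
- by move=> x Ux; apply/continuous_mxP => i j; exact: (Ck_on_cont (hF i j)).
move=> v; apply/IH => i j.
apply: (Ck_on_eq oU (F := 'D_v (fun x => F x i j))).
  by move=> x xU; rewrite -DE// => y; exact: dF.
exact: Ck_on_derive.
Qed.

End CkOnScalar.

Section MeanValue.
Context {R : realType} {V : normedModType R}.
Implicit Types F : V -> R.

Lemma is_derive_line F y v s : derivable F (s *: v + y) v ->
  is_derive s (1 : R) (fun t => F (t *: v + y)) ('D_v F (s *: v + y)).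
Proof.
move=> dF.
have E : (fun h : R => h^-1 *: (F ((h *: (1 : R) + s) *: v + y) - F (s *: v + y)))
       = (fun h : R => h^-1 *: (F (h *: v + (s *: v + y)) - F (s *: v + y))).
  by apply/funext => h; rewrite scalerDl [h *: 1]mulr1 addrA.
split; first by rewrite /derivable E.
by rewrite /derive E.
Qed.

(** In [differentiable_C1] the step [t] is a coordinate of a vector, hence of either sign; each sign
    needs its own interval. *)
Lemma MVT_line F y v t :
  (forall s, `|s| <= `|t| -> derivable F (s *: v + y) v) ->
  exists2 c, `|c| <= `|t| & F (t *: v + y) - F y = t * 'D_v F (c *: v + y).
Proof.
move=> dF; pose g s := F (s *: v + y); pose dg s := 'D_v F (s *: v + y).
have gD s : `|s| <= `|t| -> is_derive s (1 : R) g (dg s).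
  by move=> st; apply: is_derive_line; exact: dF.
have gC (A : set R) : (forall s, A s -> `|s| <= `|t|) ->
    {within A, continuous g}.
  move=> At; apply: continuous_in_subspaceT => s; rewrite inE => /At st.
  by apply/differentiable_continuous/derivable1_diffP; have [] := gD s st.
have g0 : g 0 = F y by rewrite /g scale0r add0r.
have [t0|t0] := leP 0 t.
- have lt_t s : s \in `[0, t] -> `|s| <= `|t|.
    by rewrite in_itv /= => /andP[s0 st]; rewrite !ger0_norm.
  have [||c] := @MVT_segment R g dg 0 t t0.
  + by move=> s; rewrite in_itv /= => /andP[s0 st]; apply: gD; apply: lt_t; rewrite in_itv/= !ltW.
  + by apply: gC => s; exact: lt_t.
  move=> /lt_t ct; rewrite g0 subr0 => E; exists c => //.
  by rewrite -/(g t) E mulrC.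
- have lt_t s : s \in `[t, 0] -> `|s| <= `|t|.
    by rewrite in_itv /= => /andP[s0 st]; rewrite (ler0_norm st) (ltr0_norm t0) lerN2.
  have [||c] := @MVT_segment R g dg t 0 (ltW t0).
  + by move=> s; rewrite in_itv /= => /andP[s0 st]; apply: gD; apply: lt_t; rewrite in_itv/= !ltW.
  + by apply: gC => s; exact: lt_t.
  move=> /lt_t ct; rewrite g0 sub0r => E; exists c => //.
  by rewrite -/(g t) -opprB E mulrN opprK mulrC.
Qed.

End MeanValue.

Lemma normr_mx_coord_le (R : realType) p q (z : 'M[R]_(p, q)) i j :
  `|z i j| <= `|z|.
Proof.
rewrite [leRHS]/Num.Def.normr/= mx_normrE.
exact: (le_bigmax _ (fun i : 'I_p * 'I_q => `|z i.1 i.2|) (i, j)).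
Qed.

Section C1Differentiable.
Context {R : realType} {N : nat}.
Local Notation V := 'rV[R]_N.
Local Notation e_ i := (delta_mx 0 i : V).

(** The vertices of a path from 0 to [h] that changes one coordinate at a time, along which an
    increment of [F] telescopes. *)
Definition truncv (k : nat) (h : V) : V :=
  \row_j (if (j < k)%N then h 0 j else 0).

Lemma truncvS (i : 'I_N) h : truncv i.+1 h = h 0 i *: e_ i + truncv i h.
Proof.
apply/rowP => j; rewrite !mxE eqxx /= ltnS leq_eqVlt.
have [ij|ij] := eqVneq j i; first by rewrite ij ltnn eqxx mulr1 addr0.
by rewrite -[(j : nat) == _]/(j == i) (negbTE ij) mulr0 add0r.
Qed.

Lemma normr_row_le (h : V) (a : R) : 0 <= a -> (forall i, `|h 0 i| <= a) -> `|h| <= a.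
Proof.
move=> a0 ha; rewrite [leLHS]/Num.Def.normr/= mx_normrE (bigmax_le _ a0)//= => -[i j] _.
by rewrite ord1.
Qed.

(** [Ck_on] speaks of directional derivatives only, whereas [transversal] uses ['d]. Along the path
    of truncations the mean value theorem turns each increment into a partial derivative near [x],
    which continuity compares with its value at [x]. *)
Lemma differentiable_C1 (U : set V) (F : V -> R) (x : V) :
  open U -> U x -> Ck_on 1 U F -> differentiable F x.
Proof.
move=> oU Ux F1.
pose l (h : V) : R := \sum_i h 0 i * 'D_(e_ i) F x.
have l_lin : linear l.
  move=> a u w; rewrite /l scaler_sumr -big_split; apply: eq_bigr => i _ /=.
  by rewrite !mxE mulrDl -mulrA.
pose HB := GRing.isLinear.Build R V R *:%R l l_lin.
pose L : {linear V -> R} := HB.pack l HB.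
have Lc : continuous L.
  move=> h; apply: (@cvg_big _ _ _ _ _ add_continuous _ (nbhs h)) => i _.
  apply: cvgMr_tmp.
  exact: coord_continuous.
have LE (e : R) : 0 < e ->
    \forall h \near (0 : V), `|F (h + x) - (F x + L h)| <= e * `|h|.
  move=> e0.
  (* There are [N] increments, each with error at most [e' * |h|]; dividing by [N.+1] covers [N = 0]
     as well. *)
  have N1 : 0 < N.+1%:R :> R by rewrite ltr0n.
  pose e' := e / N.+1%:R.
  have e'0 : 0 < e' by rewrite divr_gt0.
  have : \forall y \near x, U y /\ forall i, `|'D_(e_ i) F x - 'D_(e_ i) F y| < e'.
    near=> y; split; near: y; first exact: open_nbhs_nbhs.
    apply: filter_forall => i.
    have := Ck_on_cont (Ck_on_derive (e_ i) F1) Ux.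
    by move/cvgrPdist_lt/(_ _ e'0).
  move=> /nbhs_ballP[d /= d0 dP].
  near=> h.
  have hd : `|h| < d.
    near: h; apply/nbhs_ballP; exists d => //= y.
    by rewrite -ball_normE /= sub0r normrN.
  have inb (i : 'I_N) s : `|s| <= `|h 0 i| -> ball x d (s *: e_ i + (truncv i h + x)).
    move=> sh; rewrite -ball_normE /= distrC addrA addrK.
    apply: le_lt_trans hd; apply: normr_row_le => // j; rewrite !mxE eqxx /=.
    have [->|ji] := eqVneq j i.
      by rewrite mulr1 ltnn addr0 (le_trans sh)// normr_mx_coord_le.
    by rewrite mulr0 add0r; case: ifP; rewrite ?normr0 ?normr_mx_coord_le.
  pose G (i : nat) := F (truncv i h + x).
  have GN : G N = F (h + x).
    by rewrite /G; congr (F (_ + _)); apply/rowP => j; rewrite mxE ltn_ord.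
  have G0 : G 0%N = F x.
    by rewrite /G (_ : truncv 0 h = 0) ?add0r//; apply/rowP => j; rewrite !mxE.
  have step (i : 'I_N) : `|G i.+1 - G i - h 0 i * 'D_(e_ i) F x| <= e' * `|h|.
    have [|c ch E] := @MVT_line R V F (truncv i h + x) (e_ i) (h 0 i).
      by move=> s sh; exact: Ck_on_derivable F1 (dP _ (inb i s sh)).1.
    rewrite /G truncvS -[_ + _ + x]addrA E -mulrBr normrM mulrC distrC.
    apply: ler_pM => //; first by apply/ltW/(dP _ (inb _ _ ch)).2.
    exact: normr_mx_coord_le.
  rewrite -GN -G0 opprD addrA -(telescope_sumr G)// big_mkord /l -sumrB.
  apply: (le_trans (ler_norm_sum _ _ _)).
  apply: (le_trans (ler_sum _ (fun i _ => step i))).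
  rewrite sumr_const card_ord -mulr_natl mulrA ler_wpM2r//.
  by rewrite /e' mulrC -mulrA ler_piMr ?(ltW e0)// ler_pdivrMl// mulr1 ler_nat.
have dE : 'd F x = L :> (V -> R) by apply: diff_unique => //; apply/eqaddoP.
by apply/diff_locallyP; rewrite dE; split => //; apply/eqaddoP.
Unshelve. all: by end_near. Qed.

End C1Differentiable.

Section Schwarz.
Context {R : realType} {V : normedModType R}.
Implicit Types (F : V -> R) (U : set V).

Lemma is_derive_translate F a y v : derivable F (a + y) v ->
  is_derive y v (fun z => F (a + z)) ('D_v F (a + y)).
Proof.
move=> dF.
have E : (fun h : R => h^-1 *: (F (a + (h *: v + y)) - F (a + y)))
       = (fun h : R => h^-1 *: (F (h *: v + (a + y)) - F (a + y))).
  by apply/funext => h; rewrite addrCA.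
by split; [rewrite /derivable E|rewrite /derive E].
Qed.

(** Mean value theorem twice: along [v] for the difference [F (t *: w + y) - F y], then along [w]
    for ['D_v F]. The left-hand side is symmetric in [v] and [w], which is what [derive_comm]
    exploits. *)
Lemma second_difference U F x v w t :
  (forall p q, `|p| <= `|t| -> `|q| <= `|t| -> U (q *: w + (p *: v + x))) ->
  Ck_on 2 U F ->
  exists p q, [/\ `|p| <= `|t|, `|q| <= `|t| &
    F (t *: w + (t *: v + x)) - F (t *: v + x) - (F (t *: w + x) - F x)
    = t * (t * 'D_w ('D_v F) (q *: w + (p *: v + x)))].
Proof.
move=> inU F2.
pose g y : R := F (t *: w + y) - F y.
have t0 : `|0 : R| <= `|t| by rewrite normr0.
have gD s : `|s| <= `|t| -> is_derive (s *: v + x) v g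
    ('D_v F (t *: w + (s *: v + x)) - 'D_v F (s *: v + x)).
  move=> st; apply: is_deriveB.
    by apply: is_derive_translate; exact: Ck_on_derivable F2 (inU s t st (lexx _)).
  apply: derivableP; have := Ck_on_derivable F2 (inU s 0 st t0).
  by move=> /(_ v); rewrite scale0r add0r.
have [|p pt E] := @MVT_line R V g x v t.
  by move=> s st; have [] := gD s st.
have [|q qt E'] := @MVT_line R V ('D_v F) (p *: v + x) w t.
  move=> s st; exact: Ck_on_derivable (Ck_on_derive v F2) (inU p s pt st).
exists p, q; split => //; rewrite -/(g _) -/(g _) E.
by have [_ ->] := gD p pt; rewrite E'.
Qed.

Let eq_second_difference (t A B a b c d : R) : t != 0 ->
  a - b - (c - d) = t * (t * A) -> a - c - (b - d) = t * (t * B) -> A = B.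
Proof.
move=> t0 EA EB; apply: (mulfI t0); apply: (mulfI t0).
by rewrite -EA -EB; ring.
Qed.

(** The same second difference, computed in both orders, shows that the two mixed derivatives take a
    common value at two points near [x]; continuity at [x] does the rest. *)
Lemma derive_comm U F x v w : open U -> U x -> Ck_on 2 U F ->
  'D_v ('D_w F) x = 'D_w ('D_v F) x.
Proof.
move=> oU Ux F2.
apply/eqP; rewrite -subr_eq0 -normr_le0; apply/ler_addgt0Pl => e e0.
rewrite addr0.
have e20 : 0 < e / 2 by rewrite divr_gt0.
have cD u u' : {for x, continuous ('D_u ('D_u' F))}.
  by apply: Ck_on_cont Ux; apply: Ck_on_derive; apply: Ck_on_derive; exact: F2.
have hU : nbhs x U by exact: open_nbhs_nbhs.
have h1 : nbhs x (fun y => `|'D_v ('D_w F) x - 'D_v ('D_w F) y| < e / 2).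
  exact: (cvgrPdist_lt _ _).1 (cD v w) _ e20.
have h2 : nbhs x (fun y => `|'D_w ('D_v F) x - 'D_w ('D_v F) y| < e / 2).
  exact: (cvgrPdist_lt _ _).1 (cD w v) _ e20.
have [d /= d0 dP] := (nbhs_ballP _ _).1 (filterI hU (filterI h1 h2)).
(* Small enough for every point of the parallelogram to stay in the ball of radius [d]; the [+ 1]
   allows [v = w = 0]. *)
pose t := d / 2 / (`|v| + `|w| + 1).
have vw0 : 0 < `|v| + `|w| + 1 by rewrite ltr_pwDr// addr_ge0.
have t0 : 0 < t by rewrite !divr_gt0.
have inb u u' p q : `|u| + `|u'| = `|v| + `|w| -> `|p| <= `|t| -> `|q| <= `|t| ->
    ball x d (q *: u + (p *: u' + x)).
  move=> uE pt qt; rewrite -ball_normE /= distrC addrA addrK.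
  apply: (@le_lt_trans _ _ (t * (`|v| + `|w| + 1))).
    rewrite (le_trans (ler_normD _ _))// !normrZ -uE 2!mulrDr mulr1.
    rewrite -[leLHS]addr0 lerD ?(ltW t0)// -[t]gtr0_norm//.
    by rewrite lerD// ler_wpM2r.
  by rewrite /t divfK ?gt_eqF// ltr_pdivrMr// ltr_pMr// ltr1n.
have [|p [q [pt qt E1]]] := @second_difference U F x v w t _ F2.
  by move=> p q pt qt; have [+ _] := dP _ (inb w v p q (addrC _ _) pt qt).
have [|p' [q' [pt' qt' E2]]] := @second_difference U F x w v t _ F2.
  by move=> p' q' pt' qt'; have [+ _] := dP _ (inb v w p' q' erefl pt' qt').
have EE : 'D_w ('D_v F) (q *: w + (p *: v + x)) =
          'D_v ('D_w F) (q' *: v + (p' *: w + x)).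
  have tt : t != 0 by rewrite gt_eqF.
  have XE : t *: v + (t *: w + x) = t *: w + (t *: v + x) by exact: addrCA.
  rewrite XE in E2; exact: eq_second_difference tt E1 E2.
have [_ [_ k1]] := dP _ (inb w v p q (addrC _ _) pt qt).
have [_ [k2 _]] := dP _ (inb v w p' q' erefl pt' qt').
rewrite -EE in k2.
rewrite -(subrKA ('D_w ('D_v F) (q *: w + (p *: v + x)))) (splitr e).
rewrite distrC in k1.
exact: le_trans (ler_normD _ _) (lerD (ltW k2) (ltW k1)).
Unshelve. all: by end_near. Qed.

End Schwarz.

Section MatrixValued.
Context {R : realType} {N p q : nat}.
Local Notation V := 'rV[R]_N.
Implicit Types (F G : V -> 'M[R]_(p, q)) (U : set V).

Lemma derive_comm_mx U F x v w : open U -> U x -> Ck_on 2 U F ->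
  'D_v ('D_w F) x = 'D_w ('D_v F) x.
Proof.
move=> oU Ux F2; have /(Ck_on_mxP 2 F oU) F2c := F2.
have E u u' i j : ('D_u ('D_u' F) x) i j = 'D_u ('D_u' (fun y => F y i j)) x.
  rewrite derive_mx ?mxE; last exact: Ck_on_derivable (Ck_on_derive u' F2) Ux.
  apply: (@derive_eq_on _ _ _ U) => //; last by rewrite inE.
  move=> y; rewrite inE => Uy.
  by rewrite derive_mx ?mxE//; exact: Ck_on_derivable F2 Uy.
apply/matrixP => i j.
apply: etrans (E v w i j) _; apply: etrans _ (esym (E w v i j)).
exact: (@derive_comm _ _ U (fun y => F y i j) x v w oU Ux (F2c i j)).
Qed.

Lemma differentiable_C1_mx U F x : open U -> U x -> Ck_on 1 U F ->
  differentiable F x.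
Proof.
move=> oU Ux /(Ck_on_mxP 1 F oU) F1.
have -> : F = \sum_i \sum_j (fun y => F y i j *: delta_mx i j).
  apply/funext => y; rewrite fct_sumE [LHS]matrix_sum_delta.
  by apply: eq_bigr => i _; rewrite fct_sumE.
apply: differentiable_sum => i; apply: differentiable_sum => j.
by apply: differentiableZl; exact: differentiable_C1 (F1 i j).
Qed.

Lemma eq_diff_C1_mx U F G x : open U -> U x -> Ck_on 1 U F -> Ck_on 1 U G ->
  (forall i, 'D_(delta_mx 0 i) F x = 'D_(delta_mx 0 i) G x) ->
  'd F x = 'd G x :> (V -> 'M[R]_(p, q)).
Proof.
move=> oU Ux F1 G1 FG; apply/funext => v.
have E (H : V -> 'M[R]_(p, q)) : Ck_on 1 U H ->
    'd H x v = \sum_i v 0 i *: 'D_(delta_mx 0 i) H x.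
  move=> H1; have dH := differentiable_C1_mx oU Ux H1.
  rewrite {1}(row_sum_delta v) (linear_sum ('d H x)); apply: eq_bigr => i _.
  by rewrite linearZ_LR (deriveE _ dH).
apply: etrans (E F F1) (etrans _ (esym (E G G1))).
by apply: eq_bigr => i _; congr (_ *: _).
Qed.

End MatrixValued.

Section IteratedPartials.
Context {R : realType} {N : nat}.
Local Notation V := 'rV[R]_N.
Local Notation e_ i := (delta_mx 0 i : V).

(** Directions are kept as a list, the head being the outermost derivative, so that inductions can
    remove a derivative at either end; multi-indices enter only through [mnm_seq]. *)
Definition dlist {W : normedModType R} (L : seq 'I_N) (F : V -> W) : V -> W :=
  foldr (fun i G => 'D_(e_ i) G) F L.

Section Codomain.
Context {W : normedModType R}.
Implicit Types (F G : V -> W) (U : set V) (L : seq 'I_N).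

Lemma dlist_rcons L i F : dlist (rcons L i) F = dlist L ('D_(e_ i) F).
Proof. by rewrite /dlist foldr_rcons. Qed.

Lemma dlist_cat L L' F : dlist (L ++ L') F = dlist L (dlist L' F).
Proof. by rewrite /dlist foldr_cat. Qed.

Lemma Ck_on_dlist k U F L : Ck_on (size L + k) U F -> Ck_on k U (dlist L F).
Proof.
elim: L k => [//|i L IH] k Fk.
by apply: (Ck_on_derive _ (IH k.+1 _)); rewrite addnS.
Qed.

Lemma dlist_eq_on U F G L : open U -> {in U, F =1 G} ->
  {in U, dlist L F =1 dlist L G}.
Proof. by move=> oU FG; elim: L => [//|i L IH]; exact: derive_eq_on. Qed.

Lemma dlistD U F G L : open U -> Ck_on (size L) U F -> Ck_on (size L) U G ->
  {in U, dlist L (F + G) =1 dlist L F + dlist L G}.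
Proof.
move=> oU; elim: L => [//|i L IH] /= F1 G1 x xU.
have {}IH := IH (Ck_on_pred F1) (Ck_on_pred G1).
have dF := @Ck_on_dlist 1 U F L; rewrite addn1 in dF.
have dG := @Ck_on_dlist 1 U G L; rewrite addn1 in dG.
rewrite (derive_eq_on _ oU IH xU); rewrite inE in xU.
exact: (deriveD (Ck_on_derivable (dF F1) xU) (Ck_on_derivable (dG G1) xU)).
Qed.

Lemma dlistZ U F c L : open U -> Ck_on (size L) U F ->
  {in U, dlist L (c *: F) =1 c *: dlist L F}.
Proof.
move=> oU; elim: L => [//|i L IH] /= F1 x xU.
have {}IH := IH (Ck_on_pred F1).
have dF := @Ck_on_dlist 1 U F L; rewrite addn1 in dF.
rewrite (derive_eq_on _ oU IH xU); rewrite inE in xU.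
exact: (deriveZ _ (Ck_on_derivable (dF F1) xU)).
Qed.

End Codomain.

Lemma dlist_mx U p q (F : V -> 'M[R]_(p, q)) L i j : open U ->
  Ck_on (size L) U F ->
  {in U, (fun x => dlist L F x i j) =1 dlist L (fun x => F x i j)}.
Proof.
move=> oU; elim: L => [//|l L IH] F1 x xU.
have {}IH := IH (Ck_on_pred F1).
have dF := @Ck_on_dlist _ 1 U F L; rewrite addn1 in dF.
have <- : 'D_(e_ l) (fun x => dlist L F x i j) x = dlist (l :: L) (fun x => F x i j) x.
  exact: (derive_eq_on _ oU IH xU).
rewrite inE in xU.
by rewrite /= (derive_mx (Ck_on_derivable (dF F1) xU)) mxE.
Qed.

Section Perm.
Context {p q : nat}.
Implicit Types (F G : V -> 'M[R]_(p, q)) (U : set V) (L : seq 'I_N).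

Lemma dlist_catC U F i L L' : open U ->
  Ck_on (size (L ++ i :: L')) U F ->
  {in U, dlist (L ++ i :: L') F =1 dlist (i :: L ++ L') F}.
Proof.
move=> oU; elim: L => [//|j L IH] F1 x xU.
have := derive_eq_on (e_ j) oU (IH (Ck_on_pred F1)) xU.
move=> /= ->; have dF := @Ck_on_dlist _ 2 U F (L ++ L').
have sz : (size (L ++ L') + 2)%N = size ((j :: L) ++ i :: L').
  by rewrite /= !size_cat /= addn2 addnS.
rewrite sz in dF; rewrite inE in xU.
exact: derive_comm_mx oU xU (dF F1).
Qed.

Lemma dlist_perm U F L L' : open U -> perm_eq L L' ->
  Ck_on (size L) U F -> {in U, dlist L F =1 dlist L' F}.
Proof.
move=> oU; elim: L L' => [|i L IH] L'.
  by move=> /perm_size/esym/size0nil -> _ x.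
move=> pL F1 x xU.
have iL' : i \in L' by rewrite -(perm_mem pL) mem_head.
case/splitPr: iL' pL => L1 L2 pL.
have sz : size (i :: L) = size (L1 ++ i :: L2) by exact: perm_size.
rewrite (dlist_catC oU _ xU) -?sz//.
have pL' : perm_eq L (L1 ++ L2).
  by rewrite -(perm_cons i) (perm_trans pL)// -cat1s perm_catCA.
exact: derive_eq_on (IH _ pL' (Ck_on_pred F1)) x xU.
Qed.

End Perm.

Section Partial.
Context {m : nat}.
Implicit Types (F G : V -> 'rV[R]_m) (U : set V) (L : seq 'I_N).

Definition mnm_seq (a : multinom N) : seq 'I_N :=
  flatten [seq nseq (a i) i | i <- enum 'I_N].

Lemma partialE a F : partial a F = dlist (mnm_seq a) F.
Proof.
rewrite /partial /mnm_seq; elim: (enum 'I_N) => [//|i s IH] /=.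
rewrite dlist_cat -IH; elim: (a i) => [//|k IHk] /=.
by rewrite IHk.
Qed.

Lemma count_mnm_seq a i : count_mem i (mnm_seq a) = a i.
Proof.
rewrite /mnm_seq count_flatten -map_comp sumnE big_map big_enum /= (bigD1 i)//=.
rewrite count_nseq /= eqxx mul1n big1 ?addn0// => j ji.
by rewrite count_nseq /= (negbTE ji).
Qed.

Lemma size_mnm_seq a : size (mnm_seq a) = mdeg a.
Proof.
rewrite mdegE /mnm_seq size_flatten /shape -map_comp sumnE big_map big_enum /=.
by apply: eq_bigr => i _; rewrite size_nseq.
Qed.

Lemma perm_mnm_seq L : exists2 a : multinom N, perm_eq L (mnm_seq a) & mdeg a = size L.
Proof.
pose a : multinom N := mpoly.Multinom [tuple count_mem i L | i < N].
have pL : perm_eq L (mnm_seq a).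
  apply/allP => i _ /=; rewrite count_mnm_seq.
  by rewrite mpoly.multinomE tnth_mktuple.
by exists a => //; rewrite -size_mnm_seq (perm_size pL).
Qed.

(** By symmetry of mixed derivatives, a list of directions may be permuted into [mnm_seq a] for a
    multi-index [a]. Jets can then be compared list by list. *)
Lemma eq_derivativesP k U F G x : open U -> U x -> Ck_on k U F -> Ck_on k U G ->
  derivatives k F x = derivatives k G x <->
  forall L, (size L <= k)%N -> dlist L F x = dlist L G x.
Proof.
move=> oU Ux Fk Gk; split=> [FG L Lk|FG].
  have [a pa sa] := perm_mnm_seq L.
  have xU : x \in U by rewrite inE.
  rewrite !(dlist_perm oU pa _ xU); [|exact: Ck_on_leq Gk|exact: Ck_on_leq Fk].
  have ak : (mdeg a < k.+1)%N by rewrite sa.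
  have /(congr1 (row (enum_rank (mpoly.BMultinom ak)))) := FG.
  by rewrite !rowK !enum_rankK /= !partialE.
apply/row_matrixP => i; rewrite !rowK !partialE FG// size_mnm_seq.
by rewrite -ltnS; exact: mpoly.bmdeg.
Qed.

Lemma Ck_on_derivatives j k U F : open U -> Ck_on (k + j) U F ->
  Ck_on j U (derivatives k F).
Proof.
move=> oU Fk; apply/(Ck_on_mxP _ _ oU) => a i.
have : Ck_on j U (partial (enum_val a) F).
  rewrite partialE; apply: Ck_on_dlist; apply: Ck_on_leq Fk.
  by rewrite leq_add2r size_mnm_seq -ltnS; exact: mpoly.bmdeg.
move=> /(Ck_on_mxP _ _ oU)/(_ 0 i); apply: Ck_on_eq => //.
by move=> x _; rewrite mxE.
Qed.

Lemma derive_derivatives k U F i x : open U -> U x -> Ck_on k.+1 U F ->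
  'D_(e_ i) (derivatives k F) x =
  \matrix_a dlist (i :: mnm_seq (enum_val a : mpoly.bmultinom _ _)) F x.
Proof.
move=> oU Ux Fk; have Fk1 : Ck_on (k + 1) U F by rewrite addn1.
have Dk := Ck_on_derivatives oU Fk1.
rewrite (derive_mx (Ck_on_derivable Dk Ux)); apply/matrixP => a j; rewrite !mxE.
set L := mnm_seq _.
have -> : (fun y => derivatives k F y a j) = (fun y => dlist L F y 0 j).
  by apply/funext => y; rewrite mxE partialE.
have sL : (size L <= k)%N.
  by rewrite size_mnm_seq -ltnS; exact: mpoly.bmdeg.
have FL : Ck_on 1 U (dlist L F).
  by apply: Ck_on_dlist; apply: Ck_on_leq Fk; rewrite addn1.
by rewrite [RHS]/= (derive_mx (Ck_on_derivable FL Ux)) mxE.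
Qed.

(** One more derivative of the partials of order at most [k] gives partials of order at most [k.+1].
    This is why transversality of an [r]-jet map is a condition on [r.+1]-jets. *)
Lemma eq_diff_derivatives k U F G x : open U -> U x ->
  Ck_on k.+1 U F -> Ck_on k.+1 U G ->
  derivatives k.+1 F x = derivatives k.+1 G x ->
  'd (derivatives k F) x = 'd (derivatives k G) x :> (V -> jet_fiber R N m k).
Proof.
move=> oU Ux Fk Gk /(eq_derivativesP oU Ux Fk Gk) FG.
have Fk1 : Ck_on (k + 1) U F by rewrite addn1.
have Gk1 : Ck_on (k + 1) U G by rewrite addn1.
apply: (eq_diff_C1_mx oU Ux (Ck_on_derivatives oU Fk1) (Ck_on_derivatives oU Gk1)).
move=> i; rewrite (derive_derivatives i oU Ux Fk) (derive_derivatives i oU Ux Gk).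
apply: eq_mx => a j; congr (fun_of_matrix _ 0 j); apply: FG.
rewrite /= ltnS size_mnm_seq -ltnS.
exact: mpoly.bmdeg.
Qed.

End Partial.

End IteratedPartials.

(** * Functions on the sphere and their jets *)

Section Punctured.
Context {R : realType} {N : nat}.
Local Notation V := 'rV[R]_N.
Local Notation e_ i := (delta_mx 0 i : V).
Local Notation U0 := [set y : V | y != 0].

Lemma open_punctured : open U0.
Proof.
have -> : U0 = ~` [set 0] by apply/seteqP; split=> y /= /eqP.
apply: closed_openC; apply: accessible_closed_set1.
by apply: hausdorff_accessible; exact: norm_hausdorff.
Qed.

Lemma enorm_gt0 (y : V) : y != 0 -> 0 < enorm y.
Proof.
move=> y0; rewrite sqrtr_gt0 lt_neqAle sumr_ge0 ?andbT; last first.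
  by move=> i _; exact: sqr_ge0.
rewrite eq_sym; apply: contra y0 => /eqP/psumr_eq0P yi.
apply/eqP/rowP => i; rewrite mxE; apply/eqP.
by rewrite -sqrf_eq0 yi// => j _; exact: sqr_ge0.
Qed.

Definition smooth0 (F : V -> R) : Prop := forall k, Ck_on k U0 F.

Lemma smooth0_cst c : smooth0 (cst c).
Proof. by move=> k; apply: Ck_on_cst; exact: open_punctured. Qed.

Lemma smooth0D F G : smooth0 F -> smooth0 G -> smooth0 (F + G).
Proof. by move=> f g k; apply: Ck_onD => //; exact: open_punctured. Qed.

Lemma smooth0M F G : smooth0 F -> smooth0 G -> smooth0 (F * G).
Proof. by move=> f g k; apply: Ck_onM => //; exact: open_punctured. Qed.

Lemma smooth0Z c F : smooth0 F -> smooth0 (c *: F).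
Proof. by move=> f k; apply: Ck_onZ => //; exact: open_punctured. Qed.

Lemma smooth0_sum (I : Type) (s : seq I) (P : pred I) (F : I -> V -> R) :
  (forall i, P i -> smooth0 (F i)) -> smooth0 (\sum_(i <- s | P i) F i).
Proof.
by move=> hF; elim/big_ind: _ => //; [exact: smooth0_cst|exact: smooth0D].
Qed.

Lemma smooth0_prod (I : Type) (s : seq I) (P : pred I) (F : I -> V -> R) :
  (forall i, P i -> smooth0 (F i)) -> smooth0 (\prod_(i <- s | P i) F i).
Proof.
by move=> hF; elim/big_ind: _ => //; [exact: smooth0_cst|exact: smooth0M].
Qed.

Lemma smooth0X F j : smooth0 F -> smooth0 (F ^+ j).
Proof.
move=> hF; elim: j => [|j IH]; first by rewrite expr0; exact: smooth0_cst.
by rewrite exprS; exact: smooth0M.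
Qed.

Lemma smooth0_derive F v : smooth0 F -> smooth0 ('D_v F).
Proof. by move=> hF k; exact: Ck_on_derive (hF k.+1). Qed.

Lemma derive_coord i (v y : V) : is_derive y v (fun z : V => z 0 i) (v 0 i).
Proof.
have d : derivable (@id V) y v by exact: derivable_id.
have dm := (derivable_mxP _ _ _).1 d 0 i.
split; first exact: dm.
by have := derive_mx d; rewrite derive_id => /matrixP/(_ 0 i); rewrite mxE => ->.
Qed.

Lemma smooth0_coord i : smooth0 (fun y : V => y 0 i).
Proof.
case=> [|k]; first by split => // y _; exact: coord_continuous.
split; [|split].
- by move=> y _; exact: coord_continuous.
- by move=> v y _; have [] := derive_coord i v y.
move=> v; apply: (Ck_on_eq open_punctured (F := cst (v 0 i))).
  by move=> y _; have [_ ->] := derive_coord i v y.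
exact: smooth0_cst.
Qed.

Let sqnorm : V -> R := \sum_i (fun y : V => y 0 i) ^+ 2.

Let sqnormE y : sqnorm y = \sum_i y 0 i ^+ 2.
Proof. by rewrite /sqnorm fct_sumE. Qed.

Let smooth0_sqnorm : smooth0 sqnorm.
Proof. by apply: smooth0_sum => i _; apply: smooth0X; exact: smooth0_coord. Qed.

(** The function [s = 1 / |y|] satisfies [D_v s = - s^3 / 2 * D_v |y|^2]. So if [s] is of class C^k,
    then so are its derivatives, and induction on [k] applies. *)
Lemma smooth0_enormV : smooth0 (fun y => (enorm y)^-1).
Proof.
set s := fun y => _.
have N0 y : y != 0 -> 0 < sqnorm y.
  by move=> /enorm_gt0; rewrite sqrtr_gt0 -sqnormE.
pose phi (t : R) := (Num.sqrt t)^-1.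
have sE : s = phi \o sqnorm.
  by apply/funext => y; rewrite /s /phi /= /enorm -sqnormE.
have dphi (t : R) : 0 < t -> is_derive t (1 : R) phi (- (2^-1 * (phi t) ^+ 3)).
  move=> t0; have q0 : Num.sqrt t != 0 by rewrite gt_eqF ?sqrtr_gt0.
  have [dq Dq] := is_derive1_sqrt t0.
  split; first exact: derivableV q0 dq.
  rewrite (deriveV q0 dq) Dq /phi -[_ *: _]/(_ * _) [(2 * _)^-1]invfM -exprVn.
  by move: (Num.sqrt t)^-1 => q; ring.
have ds y v : y != 0 ->
    is_derive y v s (- (2^-1 * s y ^+ 3 * 'D_v sqnorm y)).
  move=> y0; rewrite sE.
  have dN : differentiable sqnorm y.
    exact: differentiable_C1 open_punctured _ (smooth0_sqnorm 1).
  have [dp Dp] := dphi _ (N0 _ y0).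
  have dP : differentiable phi (sqnorm y) by exact/derivable1_diffP.
  have dc : differentiable (phi \o sqnorm) y by exact: differentiable_comp.
  split; first exact: diff_derivable.
  rewrite (deriveE _ dc) (diff_comp dN dP) /= (deriv1E dp) derive1E Dp.
  by rewrite -(deriveE _ dN) /= -[_ *: _]/(_ * _); ring.
elim=> [|k IH].
  split => // y y0; apply: differentiable_continuous.
  rewrite sE; apply: differentiable_comp.
    exact: differentiable_C1 open_punctured _ (smooth0_sqnorm 1).
  by apply/derivable1_diffP; have [] := dphi _ (N0 _ y0).
split; [|split].
- by move=> y y0; exact: Ck_on_cont IH y0.
- by move=> v y y0; have [] := ds y v y0.
move=> v; apply: (Ck_on_eq open_punctured (F := (- 2^-1) *: (s ^+ 3 * 'D_v sqnorm))).
  move=> y; rewrite inE => y0; have [_ ->] := ds y v y0.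
  by rewrite -[LHS]/(_ * (_ * _)) -[(s ^+ 3) y]/((s * (s * s)) y) /= !mulrA; ring.
apply: Ck_onZ open_punctured _; apply: Ck_onM open_punctured _ _; last first.
  exact: Ck_on_derive (smooth0_sqnorm k.+1).
exact: (Ck_onM open_punctured IH (Ck_onM open_punctured IH IH)).
Qed.

Section Vanish.
Variable x : V.
Hypothesis x0 : x != 0.

Definition vanish {W : normedModType R} (t : nat) (F : V -> W) : Prop :=
  forall L, (size L < t)%N -> dlist L F x = 0.

Lemma vanish_leq (W : normedModType R) s t (F : V -> W) :
  (s <= t)%N -> vanish t F -> vanish s F.
Proof. by move=> st hF L Ls; apply: hF; exact: leq_trans st. Qed.

Lemma vanish1 (F : V -> R) : F x = 0 -> vanish 1 F.
Proof. by move=> Fx [|]. Qed.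

Lemma vanish_derive t (F : V -> R) i : vanish t F -> vanish t.-1 ('D_(e_ i) F).
Proof.
move=> hF L Lt; rewrite -dlist_rcons; apply: hF.
by rewrite size_rcons; case: t Lt.
Qed.

(** Leibniz rule for the innermost derivative: each of the two terms loses one order on one factor.
    Orders and functions both change, hence the general induction hypothesis; an order 0 stays 0
    under [.-1], which does no harm. *)
Lemma vanishM s t (F G : V -> R) : smooth0 F -> smooth0 G ->
  vanish s F -> vanish t G -> vanish (s + t) (F * G).
Proof.
move=> sF sG vF vG L; have xU : x \in U0 by rewrite inE.
elim/last_ind: L s t F G sF sG vF vG => [|L i IH] s t F G sF sG vF vG.
  rewrite addn_gt0 => /orP[s0|t0].
    by rewrite /dlist /= -[LHS]/(F x * G x) [F x](vF [::])// mul0r.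
  by rewrite /dlist /= -[LHS]/(F x * G x) [G x](vG [::])// mulr0.
rewrite size_rcons => Lst; rewrite dlist_rcons.
have E : {in U0, 'D_(e_ i) (F * G) =1 F * 'D_(e_ i) G + G * 'D_(e_ i) F}.
  move=> y; rewrite inE => y0.
  by rewrite (deriveM (Ck_on_derivable (sF 1) y0) (Ck_on_derivable (sG 1) y0)).
rewrite (dlist_eq_on L open_punctured E xU).
rewrite (dlistD open_punctured _ _ xU).
- rewrite -[LHS]/(_ + _) (IH s t.-1) ?(IH t s.-1) ?addr0 //.
  + exact: smooth0_derive.
  + exact: vanish_derive.
  + by lia.
  + exact: smooth0_derive.
  + exact: vanish_derive.
  + by lia.
- by apply: smooth0M => //; exact: smooth0_derive.
- by apply: smooth0M => //; exact: smooth0_derive.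
Qed.

Lemma vanishD t (F G : V -> R) : smooth0 F -> smooth0 G ->
  vanish t F -> vanish t G -> vanish t (F + G).
Proof.
move=> sF sG vF vG L Lt; have xU : x \in U0 by rewrite inE.
by rewrite (dlistD open_punctured (sF _) (sG _) xU) -[LHS]/(_ + _) vF// vG// addr0.
Qed.

Lemma vanishZ t c (F : V -> R) : smooth0 F -> vanish t F -> vanish t (c *: F).
Proof.
move=> sF vF L Lt; have xU : x \in U0 by rewrite inE.
by rewrite (dlistZ c open_punctured (sF _) xU) -[LHS]/(_ * _) vF// mulr0.
Qed.

Lemma vanish0 t : vanish t (0 : V -> R).
Proof.
move=> L _; have xU : x \in U0 by rewrite inE.
rewrite -[X in dlist L X](scale0r (0 : V -> R)).
by rewrite (dlistZ 0 open_punctured (smooth0_cst 0 _) xU) -[LHS]/(0 * _) mul0r.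
Qed.

Lemma vanish_sum (I : Type) (s : seq I) (F : I -> V -> R) t :
  (forall i, smooth0 (F i)) -> (forall i, vanish t (F i)) ->
  vanish t (\sum_(i <- s) F i).
Proof.
move=> sF vF; elim: s => [|i s IH]; first by rewrite big_nil; exact: vanish0.
rewrite big_cons; apply: vanishD => //.
by apply: smooth0_sum => j _; exact: sF.
Qed.

Lemma vanish_prod (I : Type) (s : seq I) (F : I -> V -> R) :
  (forall i, smooth0 (F i)) -> (forall i, F i x = 0) ->
  vanish (size s) (\prod_(i <- s) F i).
Proof.
move=> sF vF; elim: s => [|i s IH] //=; rewrite big_cons -add1n.
apply: vanishM IH => //; last exact: vanish1.
by apply: smooth0_prod => j _; exact: sF.
Qed.

Lemma vanishX t j (F : V -> R) : smooth0 F -> vanish t F -> vanish (j * t) (F ^+ j).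
Proof.
move=> sF vF; elim: j => [//|j IH]; rewrite mulSn exprS.
by apply: vanishM => //; exact: smooth0X.
Qed.

End Vanish.
End Punctured.

Section SphereProj.
Context {R : realType} {n : nat}.
Local Notation V := 'rV[R]_n.+1.
Local Notation U0 := [set y : V | y != 0].

Definition sph (y : V) : V := val (@sphere_proj R n y).

Lemma sphE y : y != 0 -> sph y = (enorm y)^-1 *: y.
Proof.
move=> /enorm_gt0 e0; rewrite /sph /sphere_proj insubdK// -topredE /=.
rewrite /enorm; under eq_bigr do rewrite mxE exprMn.
rewrite -mulr_sumr sqrtrM ?sqr_ge0// sqrtr_sqr -/(enorm y).
by rewrite ger0_norm ?invr_ge0 ?(ltW e0)// mulVf// gt_eqF.
Qed.

Lemma sphere_neq0 (x : sphere R n) : val x != 0.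
Proof.
apply: contraTneq (valP x) => ->.
rewrite /enorm big1 ?sqrtr0 ?(eq_sym 0) ?oner_eq0// => i _.
by rewrite mxE expr0n.
Qed.

Lemma sphere_projK (x : sphere R n) : sphere_proj (val x) = x.
Proof.
apply: val_inj; rewrite -[LHS]/(sph _) sphE ?sphere_neq0//.
by rewrite (eqP (valP x)) invr1 scale1r.
Qed.

Lemma sphK (x : sphere R n) : sph (val x) = val x.
Proof. by rewrite /sph sphere_projK. Qed.

Lemma sum_sphere_sqr (x : sphere R n) : \sum_i val x 0 i ^+ 2 = 1.
Proof.
have /eqP := valP x; rewrite /enorm => /(congr1 (fun t => t ^+ 2)).
by rewrite sqr_sqrtr ?expr1n// sumr_ge0// => i _; exact: sqr_ge0.
Qed.

Lemma smooth0_sph i : smooth0 (fun y : V => sph y 0 i).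
Proof.
move=> k; apply: (Ck_on_eq open_punctured
  (F := (fun y : V => (enorm y)^-1) * (fun y : V => y 0 i))).
  by move=> y; rewrite inE => y0; rewrite sphE// mxE.
apply: smooth0M; [exact: smooth0_enormV|exact: smooth0_coord].
Qed.

Lemma Ck_on_sph k : Ck_on k U0 sph.
Proof.
apply/(Ck_on_mxP _ _ open_punctured) => i j; rewrite ord1.
exact: smooth0_sph.
Qed.

Lemma smooth0_meval (p : mpoly n.+1 R) : smooth0 (fun y : V => meval (sph y 0) p).
Proof.
have -> : (fun y : V => meval (sph y 0) p) =
    \sum_(a <- mpoly.msupp p)
      mcoeff a p *: \prod_i (fun y : V => sph y 0 i) ^+ (a : multinom _) i.
  apply/funext => y; rewrite mpoly.mevalE fct_sumE; apply: eq_bigr => a _.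
  rewrite -[RHS]/(_ * _) fct_prodE; congr (_ * _).
  by apply: eq_bigr => i _; rewrite exprfctE.
apply: smooth0_sum => a _; apply: smooth0Z; apply: smooth0_prod => i _.
by apply: smooth0X; exact: smooth0_sph.
Qed.

Section Jets.
Context {m : nat}.
Implicit Types f g : sphere R n -> 'rV[R]_m.

Lemma Ck_sphere_smooth k f :
  (forall i, smooth0 (fun y => radial_ext f y 0 i)) -> Ck_sphere k f.
Proof.
by move=> hf; apply/(Ck_on_mxP _ _ open_punctured) => i j; rewrite ord1; exact: hf.
Qed.

Lemma jet_eqP k f g x : Ck_sphere k f -> Ck_sphere k g ->
  jet k f x = jet k g x <->
  forall L, (size L <= k)%N ->
    dlist L (radial_ext f) (val x) = dlist L (radial_ext g) (val x).
Proof.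
move=> fk gk.
have P := eq_derivativesP open_punctured (sphere_neq0 x) fk gk.
split=> [/(congr1 snd)/P//|/P E].
by rewrite /jet E.
Qed.

Lemma jetD_eq k f f' g g' c x :
  Ck_sphere k f -> Ck_sphere k f' -> Ck_sphere k g -> Ck_sphere k g' ->
  jet k f x = jet k f' x -> jet k g x = jet k g' x ->
  jet k (f + c *: g) x = jet k (f' + c *: g') x.
Proof.
move=> hf hf' hg hg' /(jet_eqP _ hf hf') ff' /(jet_eqP _ hg hg') gg'.
have xU : val x \in U0 by rewrite inE; exact: sphere_neq0.
have E (h h' : sphere R n -> 'rV[R]_m) L : (size L <= k)%N -> Ck_sphere k h -> Ck_sphere k h' ->
    dlist L (radial_ext (h + c *: h')) (val x) =
    dlist L (radial_ext h) (val x) + c *: dlist L (radial_ext h') (val x).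
  move=> Lk hk h'k; have hL := Ck_on_leq Lk hk; have h'L := Ck_on_leq Lk h'k.
  rewrite -[radial_ext (h + _)]/(radial_ext h + c *: radial_ext h').
  rewrite (dlistD open_punctured hL (Ck_onZ c open_punctured h'L) xU).
  by rewrite -[LHS]/(_ + _) (dlistZ c open_punctured h'L xU).
have S (h h' : sphere R n -> 'rV[R]_m) : Ck_sphere k h -> Ck_sphere k h' -> Ck_sphere k (h + c *: h').
  move=> hk h'k; rewrite /Ck_sphere.
  rewrite -[radial_ext (h + _)]/(radial_ext h + c *: radial_ext h').
  exact: Ck_onD open_punctured hk (Ck_onZ c open_punctured h'k).
apply: (jet_eqP x (S _ _ hf hg) (S _ _ hf' hg')).2 => L Lk.
by rewrite (E f g)// (E f' g')// ff'// gg'.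
Qed.

Lemma jet_eq_vanish k f g x :
  (forall i, smooth0 (fun y => radial_ext f y 0 i)) ->
  (forall i, smooth0 (fun y => radial_ext g y 0 i)) ->
  (forall i, vanish (val x) k.+1
    (fun y => radial_ext f y 0 i - radial_ext g y 0 i)) ->
  jet k f x = jet k g x.
Proof.
move=> sf sg v; have fk := Ck_sphere_smooth k sf.
have gk := Ck_sphere_smooth k sg.
have xU : val x \in U0 by rewrite inE; exact: sphere_neq0.
apply/(jet_eqP _ fk gk) => L Lk; apply/rowP => i.
have E (h : sphere R n -> 'rV[R]_m) (hk : Ck_sphere k h) := dlist_mx 0 i open_punctured (Ck_on_leq Lk hk) xU.
rewrite (E _ fk) (E _ gk); apply/subr0_eq; rewrite -[RHS](v i L Lk).
pose F y := radial_ext f y 0 i; pose G y := radial_ext g y 0 i.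
have -> : (fun y => radial_ext f y 0 i - radial_ext g y 0 i) = F + -1 *: G.
  by apply/funext => y; rewrite -[RHS]/(_ + _ * _) mulN1r.
rewrite (dlistD open_punctured (sf i _) (smooth0Z (-1) (sg i) _) xU).
by rewrite -[RHS]/(_ + _) (dlistZ (-1) open_punctured (sg i _) xU) -[X in _ = _ + X]/(_ * _) mulN1r.
Qed.

(** The radial extension of the jet map is the pair of [sph] and
    [derivatives r (radial_ext f) \o sph]. As [sph] fixes [x], the chain rule expresses its
    differential at [x] by the differential of [derivatives r] at [x] itself. *)
Lemma transversal_at_jet r f g x : Ck_sphere r.+1 f -> Ck_sphere r.+1 g ->
  jet r.+1 f x = jet r.+1 g x ->
  jet r f x = jet r g x /\
  'd (radial_ext (jet r f)) (val x) = 'd (radial_ext (jet r g)) (val x)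
    :> (V -> jet_ambient R n m r).
Proof.
move=> fk gk E; have x0 := sphere_neq0 x; split.
  apply/(jet_eqP _ (Ck_on_pred fk) (Ck_on_pred gk)) => L Lr.
  by have /(jet_eqP _ fk gk) -> // := E; exact: leqW.
have dE := eq_diff_derivatives open_punctured x0 fk gk (congr1 snd E).
have ds : differentiable sph (val x).
  exact: differentiable_C1_mx open_punctured x0 (Ck_on_sph 1).
have D (h : sphere R n -> 'rV[R]_m) : Ck_sphere r.+1 h ->
    'd (radial_ext (jet r h)) (val x) =
    (fun v => ('d sph (val x) v,
      'd (derivatives r (radial_ext h)) (val x) ('d sph (val x) v)))
    :> (V -> jet_ambient R n m r).
  move=> hk.
  have hk1 : Ck_on (r + 1) U0 (radial_ext h) by rewrite addn1.
  have dd : differentiable (derivatives r (radial_ext h)) (sph (val x)).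
    rewrite sphK; apply: differentiable_C1_mx open_punctured x0 _.
    exact: Ck_on_derivatives open_punctured hk1.
  have -> : radial_ext (jet r h) =
      fun y => (sph y, (derivatives r (radial_ext h) \o sph) y) by [].
  rewrite (diff_pair ds (differentiable_comp ds dd)).
  have dc := diff_comp ds dd; rewrite sphK in dc.
  by apply/funext => v; congr (_, _); exact: (congr1 (fun h => h v) dc).
apply: etrans (D f fk) (etrans _ (esym (D g gk))); apply/funext => v.
exact: (congr1 (fun h => ('d sph (val x) v, h ('d sph (val x) v))) dE).
Qed.

End Jets.
End SphereProj.

(** * The Fischer inner product *)

Section Fischer.
Context {R : realType} {N : nat}.
Implicit Types (p q : mpoly N R) (a : multinom N).
Local Notation mX i := (mpolyX R (mnm1 i) : mpoly N R).

Definition mnm_fact a : nat := (\prod_i (a i)`!)%N.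

(* Without the factor [1 / d`!] of the Bombieri-Weyl product, which would break
   the adjunction between multiplication and derivation. *)
Definition fischer p q : R :=
  \sum_(a <- msupp p) (mnm_fact a)%:R * (mcoeff a p * mcoeff a q).

Lemma fischer_big (s : seq (multinom N)) p q : uniq s ->
  {subset msupp p <= s} ->
  fischer p q = \sum_(a <- s) (mnm_fact a)%:R * (mcoeff a p * mcoeff a q).
Proof.
move=> us ps; rewrite [RHS](bigID (mem (msupp p))) /= [X in _ + X]big1 ?addr0.
  rewrite -[RHS]big_filter; apply: perm_big; apply: uniq_perm.
  - exact: msupp_uniq.
  - exact: filter_uniq.
  by move=> a; rewrite mem_filter; case: (boolP (a \in msupp p)) => //= /ps ->.
by move=> a /memN_msupp_eq0 ->; rewrite mul0r mulr0.
Qed.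

Lemma fischerC p q : fischer p q = fischer q p.
Proof.
pose s := undup (msupp p ++ msupp q).
rewrite (@fischer_big s p q) ?undup_uniq//; last first.
  by move=> a; rewrite mem_undup mem_cat => ->.
rewrite (@fischer_big s q p) ?undup_uniq//; last first.
  by move=> a; rewrite mem_undup mem_cat => ->; rewrite orbT.
by apply: eq_bigr => a _; rewrite (mulrC (mcoeff a p)).
Qed.

Lemma fischerDr p q q' : fischer p (q + q') = fischer p q + fischer p q'.
Proof.
by rewrite -big_split; apply: eq_bigr => a _ /=; rewrite mcoeffD !mulrDr.
Qed.

Lemma fischerZr c p q : fischer p (c *: q) = c * fischer p q.
Proof.
rewrite mulr_sumr; apply: eq_bigr => a _ /=.
by rewrite mcoeffZ; ring.
Qed.

Lemma fischerDl p p' q : fischer (p + p') q = fischer p q + fischer p' q.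
Proof. by rewrite fischerC fischerDr !(fischerC q). Qed.

Lemma fischerZl c p q : fischer (c *: p) q = c * fischer p q.
Proof. by rewrite fischerC fischerZr fischerC. Qed.

Lemma fischer0r p : fischer p 0 = 0.
Proof. by rewrite -(scale0r p) fischerZr mul0r. Qed.

Lemma fischer0l p : fischer 0 p = 0.
Proof. by rewrite fischerC fischer0r. Qed.

Lemma fischer_ge0 p : 0 <= fischer p p.
Proof.
by apply: sumr_ge0 => a _; rewrite mulr_ge0// -expr2 sqr_ge0.
Qed.

Lemma fischer1 : fischer 1 1 = 1.
Proof.
rewrite /fischer msupp1 big_seq1 mcoeff1 eqxx !mulr1 /mnm_fact big1// => i _.
by rewrite mnm0E.
Qed.

(** The inequality [fischer (p - q) (p - q) >= 0], expanded. Such crude factors are harmless, since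
    they depend only on the number of summands. *)
Lemma fischerD_le p q :
  fischer (p + q) (p + q) <= 2 * fischer p p + 2 * fischer q q.
Proof.
rewrite -subr_ge0; have := fischer_ge0 (p - q).
rewrite -scaleN1r !fischerDl !fischerDr !fischerZl !fischerZr (fischerC q p).
by move=> h; apply: le_trans h _; rewrite le_eqVlt; apply/orP; left; apply/eqP; ring.
Qed.

Lemma fischer_sum_le (I : Type) (s : seq I) (F : I -> mpoly N R) (c : R) :
  0 <= c -> (forall i, fischer (F i) (F i) <= c) ->
  fischer (\sum_(i <- s) F i) (\sum_(i <- s) F i) <= 4 ^+ size s * c.
Proof.
move=> c0 hF; elim: s => [|i s IH]; first by rewrite big_nil fischer0l expr0 mul1r.
rewrite big_cons; apply: le_trans (fischerD_le _ _) _.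
have h4 : 1 <= 4 ^+ size s :> R by rewrite exprn_ege1// ler1n.
have hc : c <= 4 ^+ size s * c by rewrite ler_peMl.
rewrite /= exprS; have := hF i; move: IH hc; rewrite -mulrA.
move: (4 ^+ size s * c) => z; lra.
Qed.

Lemma mnm_factU i a : mnm_fact (mnm_add (mnm1 i) a) = ((a i).+1 * mnm_fact a)%N.
Proof.
rewrite /mnm_fact (bigD1 i)//= [in RHS](bigD1 i)//= mnmDE mnm1E eqxx add1n.
rewrite factS mulnA; congr (_ * _)%N; apply: eq_bigr => j ji.
by rewrite mnmDE mnm1E eq_sym (negbTE ji).
Qed.

(** The weights [a!] are made for this: raising the exponent of the variable [i] multiplies the
    weight by [a_i + 1], the factor that differentiation produces. *)
Lemma fischer_mulX i p q : fischer (p * mX i) q = fischer p (mderiv i q).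
Proof.
rewrite /fischer (perm_big _ (msuppMX p (mnm1 i))) /= big_map.
apply: eq_bigr => a _; rewrite mnm_factU mcoeffMX mcoeff_deriv [mnm_add a _]addmC.
by rewrite natrM; ring.
Qed.

Lemma fischer_mulX_le d i p : p \is ishomog1 d mdeg ->
  fischer (p * mX i) (p * mX i) <= d.+1%:R * fischer p p.
Proof.
move=> /dhomogP hp; rewrite /fischer (perm_big _ (msuppMX p (mnm1 i))) /= big_map.
rewrite mulr_sumr !big_seq; apply: ler_sum => a ap.
rewrite mnm_factU !mcoeffMX natrM -mulrA ler_wpM2r//.
  by rewrite mulr_ge0// -expr2 sqr_ge0.
have <- : mdeg a = d := hp a ap.
rewrite ler_nat ltnS mdegE (bigD1 i)//=; exact: leq_addr.
Qed.

Definition lform (w : 'rV[R]_N) : mpoly N R := \sum_i w 0 i *: mX i.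

Definition dderiv (w : 'rV[R]_N) p : mpoly N R := \sum_i w 0 i *: mderiv i p.

Lemma fischer_sumr (I : Type) (s : seq I) p (F : I -> mpoly N R) :
  fischer p (\sum_(i <- s) F i) = \sum_(i <- s) fischer p (F i).
Proof.
by elim/big_rec2: _ => [|i x y _ <-]; rewrite ?fischer0r// fischerDr.
Qed.

Lemma fischer_lform w p q : fischer (lform w * p) q = fischer p (dderiv w q).
Proof.
rewrite /lform /dderiv mulr_suml fischerC !fischer_sumr; apply: eq_bigr => i _.
by rewrite -scalerAl !fischerZr [_ * p]mulrC (fischerC q) fischer_mulX.
Qed.

Lemma dderivM w p q : dderiv w (p * q) = dderiv w p * q + p * dderiv w q.
Proof.
rewrite /dderiv mulr_suml mulr_sumr -big_split; apply: eq_bigr => i _ /=.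
by rewrite mderivM scalerDr scalerAl scalerAr.
Qed.

Lemma dderiv_lform v w : dderiv v (lform w) = (\sum_i v 0 i * w 0 i) *: 1.
Proof.
rewrite /dderiv scaler_suml; apply: eq_bigr => i _; rewrite -scalerA; congr (_ *: _).
rewrite /lform raddf_sum /= (bigD1 i)//= big1 ?addr0.
  rewrite mderivZ mderivX mnm1E eqxx scale1r; congr (_ *: _).
  rewrite (_ : mnm_sub _ _ = mnm0) ?mpolyX0//.
  by apply/mnmP => j; rewrite mnmBE mnm0E subnn.
move=> j ji; rewrite mderivZ mderivX mnm1E (negbTE ji) scale0r scaler0 //.
Qed.

Lemma dderiv1 w : dderiv w 1 = 0.
Proof.
rewrite /dderiv big1// => i _.
by rewrite -[1]mpolyC1 mderivC scaler0.
Qed.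

Lemma dderiv_eq0M w p q : dderiv w p = 0 -> dderiv w q = 0 -> dderiv w (p * q) = 0.
Proof. by move=> p0 q0; rewrite dderivM p0 q0 mul0r mulr0 addr0. Qed.

Lemma dderiv_eq0X w p j : dderiv w p = 0 -> dderiv w (p ^+ j) = 0.
Proof.
move=> p0; elim: j => [|j IH]; first by rewrite expr0 dderiv1.
by rewrite exprS; exact: dderiv_eq0M.
Qed.

Lemma dderivD w p q : dderiv w (p + q) = dderiv w p + dderiv w q.
Proof.
rewrite /dderiv -big_split; apply: eq_bigr => i _ /=.
by rewrite mderivD scalerDr.
Qed.

Lemma dderiv_lformX (x : 'rV[R]_N) e : \sum_i x 0 i ^+ 2 = 1 ->
  dderiv x (lform x ^+ e) = e%:R *: lform x ^+ e.-1.
Proof.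
move=> x1; have dx : dderiv x (lform x) = 1.
  rewrite dderiv_lform -[RHS]scale1r -[X in _ = X *: _]x1; congr (_ *: _).
case: e => [|e]; first by rewrite expr0 dderiv1 scale0r.
elim: e => [|e IH]; first by rewrite expr1 dx expr0 scale1r.
rewrite exprS dderivM dx mul1r IH /= -scalerAr -exprS.
by rewrite -[X in X + _]scale1r -scalerDl nat1r.
Qed.

(* The directional derivative along [x] is adjoint to the multiplication by
   [lform x], so the factors [lform x] peel off one by one. *)
Lemma fischer_lformXM (x : 'rV[R]_N) e p : \sum_i x 0 i ^+ 2 = 1 -> dderiv x p = 0 ->
  fischer (lform x ^+ e * p) (lform x ^+ e * p) = e`!%:R * fischer p p.
Proof.
move=> x1 dp; elim: e => [|e IH]; first by rewrite expr0 !mul1r.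
rewrite {1}exprS -mulrA fischer_lform dderivM dp mulr0 addr0.
rewrite dderiv_lformX// -scalerAl fischerZr IH factS natrM mulrA; congr (_ * _).
Qed.

Lemma dhomog_lform w : lform w \is ishomog1 1 mdeg.
Proof.
by apply: rpred_sum => i _; apply: rpredZ; rewrite dhomogX /= mdeg1.
Qed.

(** The bound 2 is the one satisfied by the vectors [tang_vec]. Of the factors 4, [N] come from
    summing over the coordinates and one from the square of a coefficient. *)
Lemma fischer_lform_le d (w : 'rV[R]_N) p : p \is ishomog1 d mdeg ->
  (forall i, `|w 0 i| <= 2) ->
  fischer (lform w * p) (lform w * p) <= 4 ^+ N.+1 * (d.+1%:R * fischer p p).
Proof.
move=> hp hw; rewrite /lform mulr_suml.
have -> : 4 ^+ N.+1 * (d.+1%:R * fischer p p) =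
   4 ^+ size (index_enum 'I_N) * (4 * (d.+1%:R * fischer p p)) :> R.
  by rewrite /index_enum unlock -enumT size_enum_ord exprSr -mulrA.
apply: fischer_sum_le; first by rewrite !mulr_ge0// fischer_ge0.
move=> i; rewrite -scalerAl fischerZl fischerZr [_ * p]mulrC mulrA.
apply: ler_pM; rewrite -?expr2 ?sqr_ge0 ?fischer_ge0 ?fischer_mulX_le//.
rewrite -real_normK ?num_real// expr2 (_ : 4 = 2 * 2); last by rewrite -natrM.
exact: ler_pM.
Qed.

End Fischer.

(** * Homogeneous polynomials with a prescribed jet *)

Section Binomial.
Context {R : realType}.

(* The Taylor coefficients at 0 of [t |-> (1 + t) ^ ((e - k) / 2)]: on the
   sphere, with [t = (1 - s^2) / s^2], this function is [s ^ (k - e)]. *)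
Fixpoint bin_coef (e k j : nat) : R :=
  if j is j'.+1 then
    bin_coef e k j' * ((e%:R - k%:R - (2 * j')%:R) / (2 * j'.+1)%:R)
  else 1.

(** At ['X = <x, y>] on the sphere, [1 - 'X^2] equals [|u|^2]; each term then comes from a form of
    the same degree [e]. *)
Definition bin_poly (e k J : nat) : {poly R} :=
  \sum_(j < J.+1) bin_coef e k j *: ('X^(e - 2 * j) * (1 - 'X^2) ^+ j).

(** Each factor of the coefficient is at most [(1 + k + 2 j) d] in absolute value. Only the linear
    growth in [d] matters here. *)
Lemma bin_coef_le e k i j d : (e <= d)%N -> (0 < d)%N -> (i <= j)%N ->
  `|bin_coef e k i| <= ((1 + k + 2 * j) * d)%:R ^+ i.
Proof.
move=> ed d0; have d1 : 1 <= d%:R :> R by rewrite ler1n.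
elim: i => [_|i IH ij] /=; first by rewrite normr1 expr0.
rewrite normrM exprSr ler_pM ?IH ?(ltnW ij)//.
have i2 : 1 <= (2 * i.+1)%:R :> R by rewrite ler1n muln_gt0.
rewrite normrM normfV (ger0_norm (le_trans ler01 i2)).
rewrite ler_pdivrMr ?(lt_le_trans ltr01 i2)//.
apply: (@le_trans _ _ ((1 + k + 2 * j) * d)%:R).
  rewrite ler_norml -[_ <= _ - _ - _]subr_ge0 -[_ <= ((_ + _ + _) * _)%:R]subr_ge0.
  have h : (e + k + 2 * i <= (1 + k + 2 * j) * d)%N by nia.
  have : (e + k + 2 * i)%:R <= ((1 + k + 2 * j) * d)%:R :> R by rewrite ler_nat.
  rewrite !natrD; have := ler0n R e; have := ler0n R k; have := ler0n R (2 * i).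
  by move: (((1 + k + 2 * j) * d)%:R : R) => z *; apply/andP; split; lra.
by rewrite ler_peMr.
Qed.

Let euler (k : nat) (p : {poly R}) : {poly R} := 'X * p^`() - k%:R * p.

Let eulerD k p q : euler k (p + q) = euler k p + euler k q.
Proof. by rewrite /euler derivD; ring. Qed.

Let eulerZ k c p : euler k (c *: p) = c *: euler k p.
Proof. by rewrite /euler derivZ -!scalerAr scalerBr. Qed.

Let euler_mono k m j : euler k ('X^m * (1 - 'X^2) ^+ j.+1) =
  (m%:R - k%:R) * ('X^m * (1 - 'X^2) ^+ j.+1)
  - (2 * j.+1)%:R * ('X^(m.+2) * (1 - 'X^2) ^+ j).
Proof.
have d1 : (1 : {poly R})^`() = 0 by rewrite -polyC1 derivC.
rewrite /euler derivM derivXn (deriv_exp (1 - 'X^2)) derivB derivXn d1.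
by case: m => [|m]; rewrite /= ?exprS; ring.
Qed.

(** The sum telescopes: by [euler_mono], term [J.+1] contributes a multiple of
    ['X^(e - 2 * J) * (1 - 'X^2) ^+ J], and the recursion of [bin_coef] makes it cancel what was
    left at stage [J]. *)
Let euler_bin_poly e k J : (2 * J <= e)%N ->
  euler k (bin_poly e k J) = (bin_coef e k J * (e%:R - k%:R - (2 * J)%:R)) *:
    ('X^(e - 2 * J) * (1 - 'X^2) ^+ J).
Proof.
rewrite /bin_poly; elim: J => [|J IH] Je.
  rewrite big_ord_recr big_ord0 /= add0r muln0 subn0 expr0 mulr1 scale1r.
  rewrite subr0 mul1r /euler derivXn scalerBl !scaler_nat.
  by case: e Je => [|e] _ /=; rewrite ?exprS; ring.
rewrite big_ord_recr /= eulerD IH ?eulerZ; last lia.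
have -> : (e - 2 * J = (e - 2 * J.+1).+2)%N by lia.
have eE : e%:R = (e - 2 * J.+1)%:R + (2 * J.+1)%:R :> R by rewrite -natrD subnK.
move: (e - 2 * J.+1)%N eE => m eE; rewrite euler_mono.
set T := 'X^m * _; set S := _ * (1 - 'X^2) ^+ J.
have -> : (m%:R - k%:R) * T = (m%:R - k%:R : R) *: T.
  by rewrite scalerBl !scaler_nat mulrBl !mulr_natl.
have -> : (2 * J.+1)%:R * S = (2 * J.+1)%:R *: S by rewrite scaler_nat mulr_natl.
rewrite scalerBr !scalerA -[X in _ - X *: S]mulrA divfK ?pnatr_eq0// addrC subrK.
by congr (_ *: _); rewrite eE; ring.
Qed.

(* The operator [euler k] kills ['X^k] and sends [bin_poly e k J] to a multiple
   of [(1 - 'X^2) ^+ J]; hence each factor ['X - 1] of the difference, starting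
   from its root at 1, forces another one. *)
Lemma bin_poly_approx e k J : (2 * J <= e)%N ->
  exists K, bin_poly e k J - 'X^k = ('X - 1%:P) ^+ J.+1 * K.
Proof.
move=> Je; set H := bin_poly e k J - 'X^k.
pose A : {poly R} := 'X - 1%:P.
have [M HM] : exists M, euler k H = A ^+ J * M.
  have eX : euler k (- 'X^k) = 0.
    rewrite /euler derivN derivXn; case: (k) => [|i] /=; rewrite ?exprS; ring.
  rewrite eulerD eX addr0 euler_bin_poly//.
  have -> : 1 - 'X^2 = A * (- 'X - 1) :> {poly R} by rewrite /A polyC1; ring.
  by rewrite exprMn mulrCA scalerAr; eexists; reflexivity.
suff S i : (i <= J.+1)%N -> exists K, H = A ^+ i * K by exact: S.
elim: i => [_|[_ _|i IH iJ]]; first by exists H; rewrite expr0 mul1r.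
  suff /factor_theorem[K ->] : root H 1 by exists K; rewrite expr1 mulrC.
  rewrite /root /H /bin_poly big_ord_recl muln0 subn0 expr0 mulr1 scale1r.
  rewrite !hornerE !expr1n horner_sum big1 ?addr0 ?subrr// => j _.
  rewrite !hornerE.
  by rewrite !expr1n subrr expr0n/= !mulr0.
have [K HK] := IH (ltnW iJ).
have A1 : A^`() = 1 by rewrite /A derivB derivX derivC subr0.
have A0 : A != 0 by rewrite polyXsubC_eq0.
(* Both expressions of [euler k H] are divided by [A ^+ i]. Since [i < J], the other one keeps a
   factor [A], so evaluation at 1 leaves [i.+1 * K(1) = 0]. *)
have EK : euler k H = A ^+ i * (i.+1%:R * 'X * K + A * ('X * K^`() - k%:R * K)).
  by rewrite HK /euler derivM deriv_exp A1 /= !exprS; ring.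
have : i.+1%:R * 'X * K + A * ('X * K^`() - k%:R * K) = A ^+ (J - i) * M.
  apply: (mulfI (expf_neq0 i A0)); rewrite -EK HM mulrA -exprD subnKC//.
  by rewrite ltnW.
have -> : (J - i = (J - i.+1).+1)%N by rewrite -subSn.
move=> /(congr1 (horner^~ 1)).
have AH : A.[1] = 0 by rewrite /A !hornerE subrr.
have iH : (i.+1%:R : {poly R}).[1] = i.+1%:R by rewrite -(rmorph_nat polyC) hornerC.
rewrite hornerD !hornerM exprS hornerM AH !mul0r addr0 hornerX mulr1 iH.
move=> /eqP; rewrite mulf_eq0 pnatr_eq0 /= => K1.
have /factor_theorem[K' K'E] : root K 1 by [].
by exists K'; rewrite HK K'E -/A !exprS; ring.
Qed.

Lemma bin_poly_approx_horner e k J : (2 * J <= e)%N ->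
  exists K : {poly R}, forall s,
    \sum_(j < J.+1) bin_coef e k j * (s ^+ (e - 2 * j) * (1 - s ^+ 2) ^+ j) - s ^+ k
    = (s - 1) ^+ J.+1 * K.[s].
Proof.
move=> /(bin_poly_approx k)[K HK]; exists K => s.
have := congr1 (horner^~ s) HK; rewrite /bin_poly !hornerE horner_sum => <-.
by congr (_ - _); apply: eq_bigr => j _; rewrite !hornerE.
Qed.

(** Factor by factor: [d <= t * (d - i)] for [i < t <= d]. In this form the order [d^t] of the
    binomial (d choose t) enters the estimates. *)
Lemma expn_le_ffact t d : (t <= d)%N -> (d ^ t * (d - t)`! <= t ^ t * d`!)%N.
Proof.
move=> td; rewrite -(ffact_fact td) mulnA leq_mul2r; apply/orP; right.
rewrite ffact_prod -[X in (d ^ X <= _)%N]card_ord -[X in (_ <= _ ^ X * _)%N]card_ord.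
rewrite -!prod_nat_const -big_split /=; apply: leq_prod => i _.
have := ltn_ord i; nia.
Qed.

End Binomial.

Section Approximation.
Context {R : realType} {n : nat} (r : nat).
Local Notation V := 'rV[R]_n.+1.
Local Notation poly := (mpoly n.+1 R).
Local Notation mX i := (mpolyX R (mnm1 i) : poly).

Definition on_sphere (p : poly) (y : V) : R := meval (sph y 0) p.

(** [vanish] counts derivatives of order strictly below its index, so [r.+2] means equality of
    [r.+1]-jets. *)
Definition same_jet (x : sphere R n) (q T : poly) : Prop :=
  vanish (val x) r.+2 (on_sphere (q - T)).

(* [fischer q q] is [d`!] times the squared Bombieri-Weyl norm of [q], so that
   [C] bounds the latter uniformly in [d]. *)
Definition approx (C : R) (x : sphere R n) (T : poly) : Prop :=
  forall d, (r < d)%N -> exists q : poly,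
    [/\ q \is ishomog1 d mdeg, fischer q q <= C * d`!%:R & same_jet x q T].

Lemma on_sphereD p q : on_sphere (p + q) = on_sphere p + on_sphere q.
Proof. by apply/funext => y; rewrite /on_sphere mevalD. Qed.

Lemma on_sphereM p q : on_sphere (p * q) = on_sphere p * on_sphere q.
Proof. by apply/funext => y; rewrite /on_sphere mevalM. Qed.

Lemma on_sphereZ c p : on_sphere (c *: p) = c *: on_sphere p.
Proof. by apply/funext => y; rewrite /on_sphere mevalZ. Qed.

Lemma on_sphereX p j : on_sphere (p ^+ j) = on_sphere p ^+ j.
Proof.
elim: j => [|j IH]; last by rewrite !exprS on_sphereM IH.
by apply/funext => y; rewrite /on_sphere !expr0 meval1.
Qed.

Lemma smooth0_on_sphere p : smooth0 (on_sphere p).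
Proof. exact: smooth0_meval. Qed.

Lemma on_sphere0 : on_sphere 0 = 0.
Proof. by apply/funext => y; rewrite /on_sphere meval0. Qed.

Lemma on_sphere_at p (x : sphere R n) : on_sphere p (val x) = meval (val x 0) p.
Proof. by rewrite /on_sphere sphK. Qed.

Lemma same_jetD x p q p' q' :
  same_jet x p q -> same_jet x p' q' -> same_jet x (p + p') (q + q').
Proof.
rewrite /same_jet => h h'.
have -> : p + p' - (q + q') = (p - q) + (p' - q') by ring.
by rewrite on_sphereD; apply: vanishD => //;
  [exact: sphere_neq0|exact: smooth0_on_sphere|exact: smooth0_on_sphere].
Qed.

Lemma same_jetZ x c p q : same_jet x p q -> same_jet x (c *: p) (c *: q).
Proof.
rewrite /same_jet -scalerBr on_sphereZ => h.
by apply: vanishZ => //; [exact: sphere_neq0|exact: smooth0_on_sphere].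
Qed.

Lemma same_jet_sum x (I : Type) (s : seq I) (p q : I -> poly) :
  (forall i, same_jet x (p i) (q i)) ->
  same_jet x (\sum_(i <- s) p i) (\sum_(i <- s) q i).
Proof.
move=> h; elim: s => [|i s IH]; last by rewrite !big_cons; exact: same_jetD.
by rewrite !big_nil /same_jet subr0 on_sphere0; apply: vanish0; exact: sphere_neq0.
Qed.

Lemma approxD C C' x T T' :
  approx C x T -> approx C' x T' -> approx (2 * C + 2 * C') x (T + T').
Proof.
move=> h h' d rd; have [q [qd qC qT]] := h d rd; have [q' [qd' qC' qT']] := h' d rd.
exists (q + q'); split; [exact: dhomogD| |exact: same_jetD].
apply: le_trans (fischerD_le _ _) _; rewrite [leRHS]mulrDl -!mulrA.
by apply: lerD; rewrite ler_wpM2l.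
Qed.

Lemma approxZ C x c T : `|c| <= 1 -> approx C x T -> approx C x (c *: T).
Proof.
move=> c1 h d rd; have [q [qd qC qT]] := h d rd.
exists (c *: q); split; [exact: dhomogZ| |exact: same_jetZ].
rewrite fischerZl fischerZr mulrA -expr2 -real_normK ?num_real//.
apply: le_trans qC; rewrite ler_piMl ?fischer_ge0//.
by rewrite expr_le1.
Qed.

Section Point.
Variable x : sphere R n.

Lemma sphere_coord_le1 i : `|val x 0 i| <= 1.
Proof.
rewrite -(@ler_pXn2r _ 2)// ?nnegrE// expr1n real_normK ?num_real//.
rewrite -[leRHS](sum_sphere_sqr x) (bigD1 i)//= lerDl.
by apply: sumr_ge0 => j _; exact: sqr_ge0.
Qed.

Definition radial_form : poly := lform (val x).

(** The orthogonal projection of a basis vector to the tangent space at [x]; [tang_form j] is the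
    u_j of the overview. *)
Definition tang_vec (j : 'I_n.+1) : V := delta_mx 0 j - val x 0 j *: val x.

Definition tang_form j : poly := lform (tang_vec j).

Lemma tang_formE j : tang_form j = mX j - val x 0 j *: radial_form.
Proof.
rewrite /tang_form /radial_form /lform scaler_sumr.
have -> : mX j = \sum_i (delta_mx 0 j : V) 0 i *: mX i.
  rewrite (bigD1 j)//= big1 ?addr0 ?mxE ?eqxx ?scale1r// => i ij.
  by rewrite mxE (negbTE ij) andbF scale0r.
rewrite -sumrB; apply: eq_bigr => i _.
by rewrite !mxE scalerBl scalerA.
Qed.

Lemma meval_lform (v w : V) : meval (v 0) (lform w) = \sum_i w 0 i * v 0 i :> R.
Proof.
rewrite /lform (raddf_sum (meval (v 0))); apply: eq_bigr => i _.
by rewrite /= mevalZ mevalXU.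
Qed.

Lemma on_sphere_radial y :
  on_sphere radial_form y = 1 - 2^-1 * \sum_i (sph y 0 i - val x 0 i) ^+ 2.
Proof.
rewrite /on_sphere meval_lform.
have -> : \sum_i (sph y 0 i - val x 0 i) ^+ 2 =
    \sum_i sph y 0 i ^+ 2 + \sum_i val x 0 i ^+ 2 - 2 * \sum_i val x 0 i * sph y 0 i.
  rewrite mulr_sumr -big_split -sumrB; apply: eq_bigr => i _ /=; ring.
rewrite !sum_sphere_sqr; lra.
Qed.

(** Pythagoras for the unit vector [sph y]. It trades the factor [1 - l^2] of [bin_poly] for the
    quadratic form [tang_sqr]. *)
Lemma sum_tang_sqr y :
  \sum_i on_sphere (tang_form i) y ^+ 2 = 1 - on_sphere radial_form y ^+ 2.
Proof.
have E (l : R) : \sum_i (sph y 0 i - val x 0 i * l) ^+ 2 =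
    1 + l ^+ 2 - 2 * l * \sum_i val x 0 i * sph y 0 i.
  have -> : 1 + l ^+ 2 = \sum_i sph y 0 i ^+ 2 + l ^+ 2 * \sum_i val x 0 i ^+ 2.
    by rewrite !sum_sphere_sqr mulr1.
  rewrite !mulr_sumr -big_split -sumrB.
  by apply: eq_bigr => i _ /=; rewrite /sph; ring.
transitivity (\sum_i (sph y 0 i - val x 0 i * on_sphere radial_form y) ^+ 2).
  apply: eq_bigr => i _; congr (_ ^+ 2).
  by rewrite tang_formE /on_sphere mevalB mevalZ mevalXU.
rewrite E; have -> : \sum_i val x 0 i * sph y 0 i = on_sphere radial_form y.
  by rewrite /on_sphere meval_lform.
by move: (on_sphere _ _) => l; ring.
Qed.

Lemma vanish_tang j : on_sphere (tang_form j) (val x) = 0.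
Proof.
rewrite on_sphere_at tang_formE mevalB mevalZ mevalXU meval_lform.
have -> : \sum_i val x 0 i * val x 0 i = 1 by exact: sum_sphere_sqr.
by rewrite mulr1 subrr.
Qed.

(** On the sphere [l - 1] is [- |y - x|^2 / 2], a combination of squares of functions vanishing at
    [x]. *)
Lemma vanish_radial : vanish (val x) 2 (on_sphere (radial_form - 1)).
Proof.
pose F i : V -> R := on_sphere (mX i - mpolyC _ (val x 0 i)).
have FE i y : F i y = sph y 0 i - val x 0 i.
  by rewrite /F /on_sphere mevalB mevalXU mevalC.
have -> : on_sphere (radial_form - 1) = (- 2^-1) *: \sum_i F i ^+ 2.
  apply/funext => y; rewrite -[RHS]/(_ * _) fct_sumE.
  have -> : on_sphere (radial_form - 1) y = on_sphere radial_form y - 1.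
    by rewrite /on_sphere mevalB meval1.
  rewrite on_sphere_radial; under [in RHS]eq_bigr do rewrite exprfctE FE.
  ring.
have x0 := sphere_neq0 x.
have sF i : smooth0 (F i) by exact: smooth0_on_sphere.
apply: vanishZ => //; first by apply: smooth0_sum => i _; exact: smooth0X.
apply: vanish_sum => // i; first exact: smooth0X.
apply: (@vanishX _ _ _ x0 1 2) => //; apply: vanish1.
by rewrite FE sphK subrr.
Qed.

Lemma dderiv_tang j : dderiv (val x) (tang_form j) = 0.
Proof.
rewrite dderiv_lform (_ : \sum_i _ = 0) ?scale0r//.
under eq_bigr do rewrite !mxE eqxx /= mulrBr.
rewrite sumrB (bigD1 j)//= eqxx mulr1 big1 ?addr0; last first.
  by move=> i ij; rewrite (negbTE ij) mulr0.
have -> : \sum_i val x 0 i * (val x 0 j * val x 0 i) =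
    val x 0 j * \sum_i val x 0 i ^+ 2.
  by rewrite mulr_sumr; apply: eq_bigr => i _; ring.
by rewrite sum_sphere_sqr mulr1 subrr.
Qed.

Lemma tang_vec_le2 j i : `|tang_vec j 0 i| <= 2.
Proof.
rewrite !mxE eqxx /= (_ : 2 = 1 + 1)//; apply: le_trans (ler_normB _ _) _.
apply: lerD; first by case: eqP; rewrite ?normr1 ?normr0.
by rewrite normrM mulr_ile1 ?sphere_coord_le1.
Qed.

Definition tang_sqr : poly := \sum_i tang_form i ^+ 2.

Definition tang_prod (B : seq 'I_n.+1) : poly := \prod_(j <- B) tang_form j.

(** The constant of [fischer_lform_le] in [n.+1] variables. *)
Definition fischer_cst : R := 4 ^+ n.+2.

Lemma tang_prodP B : tang_prod B \is ishomog1 (size B) mdeg /\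
  fischer (tang_prod B) (tang_prod B) <= fischer_cst ^+ size B * (size B)`!%:R.
Proof.
elim: B => [|j B [Bh Bf]].
  by rewrite /tang_prod big_nil fischer1 expr0 mul1r; split => //; exact: dhomog1.
rewrite /tang_prod big_cons -/(tang_prod B); split.
  have -> : size (j :: B) = (1 + size B)%N by [].
  by apply: dhomogM => //; exact: dhomog_lform.
apply: le_trans (fischer_lform_le Bh (tang_vec_le2 j)) _.
rewrite /= -/fischer_cst [fischer_cst ^+ _.+1]exprS factS natrM -mulrA.
rewrite [fischer_cst ^+ _ * (_ * _)]mulrCA ler_pM2l ?exprn_gt0//.
by rewrite ler_pM2l ?ltr0n.
Qed.

(** Two of the three factors [fischer_cst] come from multiplying twice by a tangential form; the
    third absorbs the [4 ^+ n.+1] of the sum over coordinates. *)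
Lemma tang_sqrMP t p : p \is ishomog1 t mdeg ->
  tang_sqr * p \is ishomog1 t.+2 mdeg /\
  fischer (tang_sqr * p) (tang_sqr * p) <=
    fischer_cst ^+ 3 * (t.+2%:R * t.+1%:R * fischer p p).
Proof.
move=> ph; rewrite /tang_sqr mulr_suml; split.
  apply: rpred_sum => j _; rewrite -[t.+2]add2n; apply: dhomogM => //.
  exact: (dhomogMn 2 (dhomog_lform _)).
have K1 : 1 <= fischer_cst by rewrite exprn_ege1// ler1n.
set f := fischer p p; have f0 : 0 <= f by exact: fischer_ge0.
have step j : fischer (tang_form j ^+ 2 * p) (tang_form j ^+ 2 * p) <=
    fischer_cst ^+ 2 * (t.+2%:R * t.+1%:R * f).
  have h1 : tang_form j * p \is ishomog1 t.+1 mdeg.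
    by rewrite -[t.+1]add1n; apply: dhomogM => //; exact: dhomog_lform.
  rewrite expr2 -mulrA.
  apply: le_trans (fischer_lform_le h1 (tang_vec_le2 j)) _.
  have := fischer_lform_le ph (tang_vec_le2 j); rewrite -/fischer_cst -/f.
  set g := fischer _ _ => h2.
  rewrite -/fischer_cst; move: fischer_cst (lt_le_trans ltr01 K1) h2 => K K0 h2.
  by rewrite expr2 -!mulrA ler_pM2l// [leRHS]mulrCA ler_pM2l ?ltr0n.
apply: le_trans (fischer_sum_le _ _ step) _.
  exact: mulr_ge0 (exprn_ge0 2 (le_trans ler01 K1)) (mulr_ge0 (mulr_ge0 (ler0n _ _) (ler0n _ _)) f0).
rewrite /index_enum unlock -enumT size_enum_ord mulrA ler_wpM2r//.
  by rewrite !mulr_ge0.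
rewrite [leRHS]exprS; apply: ler_wpM2r; first exact: (exprn_ge0 2 (le_trans ler01 K1)).
by rewrite /fischer_cst ler_weXn2l ?ler1n.
Qed.

Lemma tang_monoP j B :
  tang_sqr ^+ j * tang_prod B \is ishomog1 (size B + 2 * j) mdeg /\
  fischer (tang_sqr ^+ j * tang_prod B) (tang_sqr ^+ j * tang_prod B) <=
    fischer_cst ^+ (3 * j + size B) * (size B + 2 * j)`!%:R.
Proof.
elim: j => [|j [IHh IHf]].
  by rewrite !muln0 expr0 mul1r addn0 add0n; exact: tang_prodP.
rewrite exprS -mulrA; have [h1 h2] := tang_sqrMP IHh.
have -> : (size B + 2 * j.+1 = (size B + 2 * j).+2)%N by lia.
split => //; apply: le_trans h2 _.
have -> : (3 * j.+1 + size B = 3 + (3 * j + size B))%N by lia.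
have P3 : 0 < fischer_cst ^+ 3 by rewrite !exprn_gt0.
rewrite exprD !factS !natrM; move: IHf P3.
move: (fischer_cst ^+ 3) (fischer_cst ^+ (3 * j + size B)) (fischer _ _) => K3 K f IHf P3.
rewrite -!mulrA ler_pM2l// [leRHS]mulrCA ler_pM2l ?ltr0n// [leRHS]mulrCA.
by rewrite ler_pM2l ?ltr0n.
Qed.

Lemma dderiv_tang_mono j B : dderiv (val x) (tang_sqr ^+ j * tang_prod B) = 0.
Proof.
apply: dderiv_eq0M.
  apply: dderiv_eq0X; rewrite /tang_sqr; elim/big_ind: _ => //.
  - by rewrite /dderiv big1// => i _; rewrite mderiv0 scaler0.
  - by move=> p q p0 q0; rewrite dderivD p0 q0 addr0.
  - by move=> i _; apply: dderiv_eq0X; exact: dderiv_tang.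
rewrite /tang_prod; elim/big_ind: _ => [||i _].
- exact: dderiv1.
- exact: dderiv_eq0M.
- exact: dderiv_tang.
Qed.

End Point.
End Approximation.

Section MonomialApproximation.
Context {R : realType} {n : nat} (r : nat).
Local Notation V := 'rV[R]_n.+1.
Local Notation poly := (mpoly n.+1 R).
Local Notation mX i := (mpolyX R (mnm1 i) : poly).

Lemma on_sphere_sum (I : Type) (s : seq I) (F : I -> poly) y :
  on_sphere (\sum_(i <- s) F i) y = \sum_(i <- s) on_sphere (F i) y.
Proof. by rewrite /on_sphere (raddf_sum (meval (sph y 0))). Qed.

Lemma on_sphere_prod (I : Type) (s : seq I) (F : I -> poly) :
  on_sphere (\prod_(i <- s) F i) = \prod_(i <- s) on_sphere (F i).
Proof.
elim: s => [|i s IH]; last by rewrite !big_cons on_sphereM IH.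
by rewrite !big_nil; apply/funext => y; rewrite /on_sphere meval1.
Qed.

Lemma vanish_tang_prod (x : sphere R n) B :
  vanish (val x) (size B) (on_sphere (tang_prod x B)).
Proof.
rewrite on_sphere_prod; apply: vanish_prod => [|j|j]; first exact: sphere_neq0.
  exact: smooth0_on_sphere.
exact: vanish_tang.
Qed.

Lemma vanish_leM (x : sphere R n) s t p q : vanish (val x) s (on_sphere p) ->
  vanish (val x) t (on_sphere q) -> (r.+2 <= s + t)%N ->
  vanish (val x) r.+2 (on_sphere (p * q)).
Proof.
move=> vp vq rst; rewrite on_sphereM; apply: (vanish_leq rst).
apply: vanishM vp vq; [exact: sphere_neq0|exact: smooth0_on_sphere|].
exact: smooth0_on_sphere.
Qed.

Definition approx_mono (x : sphere R n) (d k J : nat) (B : seq 'I_n.+1) : poly :=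
  \sum_(j < J.+1) bin_coef (d - size B) k j *:
    (radial_form x ^+ (d - size B - 2 * j) * (tang_sqr x ^+ j * tang_prod x B)).

(** On the sphere the difference is [(l - 1)^(J+1) K(l) u^B], which vanishes at [x] to order
    [2 (J + 1) + size B]. *)
Lemma same_jet_approx_mono x d k J B :
  (2 * J <= d - size B)%N -> (r.+2 <= 2 * J.+1 + size B)%N ->
  same_jet r x (approx_mono x d k J B) (radial_form x ^+ k * tang_prod x B).
Proof.
move=> Je Jr; have [K HK] := @bin_poly_approx_horner R _ k _ Je.
pose KP : poly := \sum_(i < size K) K`_i *: radial_form x ^+ i.
rewrite /same_jet.
have -> : on_sphere (approx_mono x d k J B - radial_form x ^+ k * tang_prod x B) =
    on_sphere ((radial_form x - 1) ^+ J.+1 * (KP * tang_prod x B)).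
  apply/funext => y; set l := on_sphere (radial_form x) y.
  set P := on_sphere (tang_prod x B) y.
  have E1 : on_sphere (approx_mono x d k J B) y =
      (\sum_(j < J.+1) bin_coef (d - size B) k j *
        (l ^+ (d - size B - 2 * j) * (1 - l ^+ 2) ^+ j)) * P.
    rewrite on_sphere_sum mulr_suml; apply: eq_bigr => j _.
    have ts : on_sphere (tang_sqr x) y = 1 - l ^+ 2.
      rewrite /tang_sqr on_sphere_sum -sum_tang_sqr; apply: eq_bigr => i _.
      by rewrite on_sphereX exprfctE.
    rewrite -ts on_sphereZ !on_sphereM !on_sphereX.
    by rewrite -[LHS]/(_ * ((_ ^+ _) y * ((_ ^+ _) y * _))) !exprfctE -!mulrA.
  have E2 : on_sphere KP y = K.[l].
    rewrite on_sphere_sum horner_coef; apply: eq_bigr => i _.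
    by rewrite on_sphereZ on_sphereX -[LHS]/(_ * _) exprfctE.
  have E3 : on_sphere (radial_form x - 1) y = l - 1.
    by rewrite /on_sphere mevalB meval1.
  have -> : on_sphere (approx_mono x d k J B - radial_form x ^+ k * tang_prod x B) y
     = on_sphere (approx_mono x d k J B) y - l ^+ k * P.
    rewrite {1}/on_sphere mevalB; congr (_ - _).
    rewrite -[LHS]/(on_sphere (radial_form x ^+ k * tang_prod x B) y).
    by rewrite on_sphereM on_sphereX -[LHS]/((_ ^+ _) y * _) exprfctE.
  rewrite E1 -mulrBl HK !on_sphereM on_sphereX.
  by rewrite -[RHS]/((_ ^+ _) y * (_ * _)) exprfctE E2 E3 mulrA.
apply: (vanish_leM (s := J.+1 * 2) (t := size B)).
- rewrite on_sphereX; apply: vanishX; [exact: sphere_neq0|exact: smooth0_on_sphere|].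
  exact: vanish_radial.
- rewrite on_sphereM -[size B]add0n; apply: vanishM.
  + exact: sphere_neq0.
  + exact: smooth0_on_sphere.
  + exact: smooth0_on_sphere.
  + by [].
  + exact: vanish_tang_prod.
- by rewrite mulnC.
Qed.

Lemma dhomog_approx_mono x d k J B :
  (2 * J + size B <= d)%N -> approx_mono x d k J B \is ishomog1 d mdeg.
Proof.
move=> Jd; apply: rpred_sum => j _; apply: rpredZ.
have jJ : (j <= J)%N by rewrite -ltnS.
have dE : d = (1 * (d - size B - 2 * j) + (size B + 2 * j))%N by lia.
rewrite [X in _ \is ishomog1 X _]dE.
apply: dhomogM; last by have [] := tang_monoP x j B.
by apply: dhomogMn; exact: dhomog_lform.
Qed.

(** With [t = b + 2 j], the square norm of term [j] is a product of three factors: the squared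
    coefficient, at most [(M d)^t]; [(d - t)!] from the powers of [l]; and a multiple of [t!] from
    the tangential part. [expn_le_ffact] turns [d^t (d - t)!] into [d!], and [t <= r.+1] removes the
    dependence on [j]. *)
Lemma fischer_approx_mono_le k b J d x B :
  (2 * J + b <= r.+1)%N -> (r < d)%N -> size B = b ->
  fischer (approx_mono x d k J B) (approx_mono x d k J B) <=
  4 ^+ J.+1 * (((1 + k + 2 * J) ^ r.+1 * (r.+1 ^ r.+1) * r.+1`!)%:R *
    @fischer_cst R n ^+ (3 * r.+1)) * d`!%:R.
Proof.
move=> Jr rd sB; set M := (1 + k + 2 * J)%N; set K := @fischer_cst R n.
have K1 : 1 <= K by rewrite exprn_ege1// ler1n.
have K0 : 0 < K by rewrite exprn_gt0.
rewrite -mulrA.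
have -> : 4 ^+ J.+1 = 4 ^+ size (index_enum 'I_J.+1) :> R.
  by rewrite /index_enum unlock -enumT size_enum_ord.
apply: fischer_sum_le; first by rewrite !mulr_ge0// exprn_ge0// ltW.
move=> j; have jJ : (j <= J)%N by rewrite -ltnS.
rewrite fischerZl fischerZr mulrA.
rewrite (fischer_lformXM _ (sum_sphere_sqr x) (dderiv_tang_mono x j B)).
have [_] := tang_monoP x j B; rewrite -/K sB.
set f := fischer _ _; set t := (b + 2 * j)%N => hf.
have td : (t <= d)%N by rewrite /t; lia.
have tr : (t <= r.+1)%N by rewrite /t; lia.
have -> : (d - b - 2 * j = d - t)%N by rewrite /t; lia.
(* The exponent [2 j] is raised to [t] to match the power in [expn_le_ffact]. *)
have c2 : (bin_coef (d - b) k j : R) * bin_coef (d - b) k j <= ((M * d) ^ t)%:R.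
  rewrite -expr2 -real_normK ?num_real//.
  have h := @bin_coef_le R (d - b) k j J d (leq_subr _ _) (leq_ltn_trans (leq0n r) rd) jJ.
  apply: (@le_trans _ _ (((M * d)%:R ^+ j) ^+ 2)).
    by rewrite ler_pXn2r ?nnegrE ?exprn_ge0.
  by rewrite -exprM -natrX ler_nat leq_pexp2l// /t /M; nia.
apply: (@le_trans _ _ (((M * d) ^ t)%:R * ((d - t)`!%:R * (K ^+ (3 * j + b) * t`!%:R)))).
  apply: ler_pM => //; first by rewrite -expr2 sqr_ge0.
    by rewrite mulr_ge0// fischer_ge0.
  by rewrite ler_wpM2l.
have KK : K ^+ (3 * j + b) <= K ^+ (3 * r.+1).
  by rewrite ler_weXn2l//; lia.
have nn : ((M * d) ^ t * (d - t)`! * t`! <=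
    M ^ r.+1 * r.+1 ^ r.+1 * r.+1`! * d`!)%N.
  have mM : (M ^ t <= M ^ r.+1)%N by rewrite leq_pexp2l.
  have mt : (t ^ t <= r.+1 ^ r.+1)%N.
    by move: (t) tr => [|u] ur; [rewrite expn_gt0|apply: (@leq_trans (r.+1 ^ u.+1)); rewrite ?leq_exp2r ?leq_pexp2l].
  have mf : (t`! <= r.+1`!)%N by exact: leq_fact.
  have mD := expn_le_ffact td.
  rewrite expnMn; move: (leq_mul (leq_mul (leq_mul mM mt) mf) (leqnn d`!)).
  have := leq_mul (leq_mul (leqnn (M ^ t)) mD) (leqnn t`!).
  by rewrite !mulnA (mulnAC _ t`! d`!) => h1 h2; exact: leq_trans h1 h2.
have h : ((M * d) ^ t * (d - t)`! * t`!)%:R * K ^+ (3 * j + b) <=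
  (M ^ r.+1 * r.+1 ^ r.+1 * r.+1`! * d`!)%:R * K ^+ (3 * r.+1).
  by apply: ler_pM => //; rewrite ?ler_nat// exprn_ge0// ltW.
apply: le_trans (le_trans _ h) _; rewrite !natrM le_eqVlt; apply/orP; left; apply/eqP.
  by rewrite [_ * t`!%:R]mulrC; ring.
by ring.
Qed.

Lemma approx_leq C C' (x : sphere R n) T :
  C <= C' -> approx r C x T -> approx r C' x T.
Proof.
move=> CC' h d rd; have [q [qd qC qT]] := h d rd; exists q; split => //.
by apply: le_trans qC _; rewrite ler_wpM2r.
Qed.

Lemma approx_sumZ (I : Type) (s : seq I) (c : I -> R) (T : I -> poly) Z C x :
  0 <= C -> (forall i, `|c i| <= Z) -> (forall i, approx r C x (T i)) ->
  approx r (4 ^+ size s * (Z ^+ 2 * C)) x (\sum_(i <- s) c i *: T i).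
Proof.
move=> C0 cZ hT d rd; have /choice[q Hq] := fun i => hT i d rd.
exists (\sum_(i <- s) c i *: q i); split.
- by apply: rpred_sum => i _; apply: rpredZ; have [] := Hq i.
- rewrite -mulrA; apply: fischer_sum_le.
    exact: mulr_ge0 (mulr_ge0 (sqr_ge0 Z) C0) (ler0n _ _).
  move=> i; have [_ qC _] := Hq i; rewrite fischerZl fischerZr mulrA -[leRHS]mulrA.
  apply: ler_pM => //; rewrite -?expr2 ?sqr_ge0 ?fischer_ge0//.
  rewrite -real_normK ?num_real// ler_pXn2r ?nnegrE//.
  exact: le_trans (cZ i).
- by apply: same_jet_sum => i; apply: same_jetZ; have [] := Hq i.
Qed.

Lemma approx_monomial k b : exists2 C : R, 0 <= C &
  forall (x : sphere R n) B, size B = b ->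
    approx r C x (radial_form x ^+ k * tang_prod x B).
Proof.
(* If [b > r.+1], the tangential product already has zero [r.+1]-jet, and the zero polynomial serves
   in every degree. *)
have [rb|br] := ltnP r.+1 b.
  exists 0 => // x B sB d rd; exists 0; split.
  - exact: rpred0.
  - by rewrite fischer0l mul0r.
  rewrite /same_jet sub0r -mulNr; apply: (@vanish_leM x 0 b) => //.
  by rewrite -sB; exact: vanish_tang_prod.
(* The largest [J] with [2 J + b <= r.+1]; then [2 J + b <= d] for the degree and
   [2 (J + 1) + b >= r.+2] for the contact. *)
pose J := ((r.+1 - b)./2)%N.
have hJ := odd_double_half (r.+1 - b); rewrite -/J in hJ.
have o1 : (odd (r.+1 - b) <= 1)%N by case: odd.
exists (4 ^+ J.+1 * (((1 + k + 2 * J) ^ r.+1 * (r.+1 ^ r.+1) * r.+1`!)%:R *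
    @fischer_cst R n ^+ (3 * r.+1))).
  by rewrite !mulr_ge0// !exprn_ge0.
move=> x B sB d rd; exists (approx_mono x d k J B); split.
- by apply: dhomog_approx_mono; rewrite sB; lia.
- by apply: (@fischer_approx_mono_le k b) => //; lia.
- by apply: same_jet_approx_mono; rewrite sB; lia.
Qed.

Definition shift_prod (x : sphere R n) (L : seq 'I_n.+1) : poly :=
  \prod_(j <- L) (mX j - mpolyC _ (val x 0 j)).

(** Induction on [l] through [y_j - x_j = u_j + x_j l - x_j], where the l on the right is the linear
    form: a shifted coordinate becomes one more tangential factor, one more radial factor, or a
    scalar. As [|x_j| <= 1], the constant depends only on the three lengths and not on [x]. *)
Lemma approx_shift_prod l k b : exists2 C : R, 0 <= C &
  forall (x : sphere R n) L B, size L = l -> size B = b ->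
    approx r C x (radial_form x ^+ k * tang_prod x B * shift_prod x L).
Proof.
elim: l k b => [|l IH] k b.
  have [C C0 hC] := approx_monomial k b; exists C => // x L B /size0nil -> sB.
  by rewrite /shift_prod big_nil mulr1; exact: hC.
have [C1 C10 h1] := IH k b.+1; have [C2 C20 h2] := IH k.+1 b.
have [C3 C30 h3] := IH k b.
exists (2 * C1 + 2 * (2 * C2 + 2 * C3)); first by lra.
move=> x [//|j L] B [sL] sB.
have -> : radial_form x ^+ k * tang_prod x B * shift_prod x (j :: L) =
    radial_form x ^+ k * tang_prod x (j :: B) * shift_prod x L +
    (val x 0 j *: (radial_form x ^+ k.+1 * tang_prod x B * shift_prod x L) +
     - val x 0 j *: (radial_form x ^+ k * tang_prod x B * shift_prod x L)).
  rewrite /shift_prod /tang_prod !big_cons tang_formE exprS scaleNr -!mul_mpolyC.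
  ring.
apply: approxD; first by apply: h1 => //=; rewrite sB.
apply: approxD; apply: approxZ.
- exact: sphere_coord_le1.
- exact: h2.
- by rewrite normrN; exact: sphere_coord_le1.
- exact: h3.
Qed.

Lemma prod_mnm_seq (S : comPzRingType) (f : 'I_n.+1 -> S) (a : multinom n.+1) :
  \prod_(j <- mnm_seq a) f j = \prod_j f j ^+ a j.
Proof.
rewrite /mnm_seq big_flatten big_map big_enum /=; apply: eq_bigr => j _.
by elim: (a j) => [|e IH]; rewrite ?big_nil ?expr0// exprS /= big_cons IH.
Qed.

End MonomialApproximation.

Section JetInterpolation.
Context {R : realType} {n m : nat} (r : nat).
Local Notation V := 'rV[R]_n.+1.

Lemma smooth0_sphere_restr (Q : 'I_m -> mpoly n.+1 R) i :
  smooth0 (fun y : V => radial_ext (sphere_restr Q) y 0 i).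
Proof.
have -> : (fun y : V => radial_ext (sphere_restr Q) y 0 i) = on_sphere (Q i).
  by apply/funext => y; rewrite /radial_ext /sphere_restr mxE.
exact: smooth0_on_sphere.
Qed.

Definition taylor_poly (x : sphere R n) (z : jet_fiber R n.+1 m r.+1) (i : 'I_m) :=
  \sum_(a < #|{: mpoly.bmultinom n.+1 r.+2}|)
    (z a i / (\prod_j ((enum_val a : multinom n.+1) j)`!)%:R) *:
    shift_prod x (mnm_seq (enum_val a : mpoly.bmultinom _ _)).

Lemma on_sphere_taylor_poly x z i :
  (fun y : V => radial_ext (fun s : sphere R n => taylor z (val s - val x)) y 0 i) =
  on_sphere (taylor_poly x z i).
Proof.
apply/funext => y; rewrite /radial_ext /taylor_poly on_sphere_sum summxE.
apply: eq_bigr => a _; rewrite on_sphereZ !mxE -[RHS]/(_ * _).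
rewrite [RHS]mulrAC mulrC mulrA; congr (_ * _ / _).
rewrite /shift_prod on_sphere_prod fct_prodE prod_mnm_seq; apply: eq_bigr => j _.
by congr (_ ^+ _); rewrite /on_sphere mevalB mevalXU mevalC !mxE.
Qed.

(** Supplies the system [Q] of the overview. The Taylor polynomial of [z] at [x] has the right jet
    without being homogeneous; each of its monomials in [y - x] is replaced by a form of the
    required degree. *)
Lemma jet_interpolation : exists2 C : R, 0 <= C &
  forall (x : sphere R n) (z : jet_fiber R n.+1 m r.+1) (d : 'I_m -> nat),
    (forall i, (r < d i)%N) ->
    exists Q : 'I_m -> mpoly n.+1 R,
      [/\ hpoly_sys R n m d Q,
          forall i, fischer (Q i) (Q i) <= C * `|z| ^+ 2 * (d i)`!%:R
        & jet r.+1 (sphere_restr Q) x = jet_restr x z].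
Proof.
have /choice[C HC] : forall l, exists C : R, 0 <= C /\
    forall (x : sphere R n) L, size L = l -> approx r C x (shift_prod x L).
  move=> l; have [C C0 hC] := @approx_shift_prod R n r l 0 0; exists C; split => //.
  move=> x L sL; have := hC x L [::] sL erefl.
  by rewrite expr0 /tang_prod big_nil !mul1r.
(* One constant for all monomials, whose degrees are at most [r.+1]. *)
pose C' := \sum_(l < r.+2) C l.
have C'0 : 0 <= C' by apply: sumr_ge0 => l _; have [] := HC l.
pose D := #|{: mpoly.bmultinom n.+1 r.+2}|.
exists (4 ^+ D * C'); first by rewrite mulr_ge0// exprn_ge0.
move=> x z d rd.
have aT i : approx r (4 ^+ D * (`|z| ^+ 2 * C')) x (taylor_poly x z i).
  have -> : D = size (index_enum 'I_D).
    by rewrite /index_enum unlock -enumT size_enum_ord.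
  apply: approx_sumZ => // a.
    rewrite normrM normfV normr_nat -[leRHS]mulr1; apply: ler_pM => //.
      exact: normr_mx_coord_le.
    rewrite invf_le1 ?ler1n ?ltr0n; last by apply: prodn_gt0 => j; exact: fact_gt0.
    by apply: prodn_gt0 => j; exact: fact_gt0.
  set L := mnm_seq _.
  have sL : (size L < r.+2)%N by rewrite size_mnm_seq; exact: mpoly.bmdeg.
  have [_ h] := HC (size L); apply: approx_leq (h x L erefl).
  rewrite /C' (bigD1 (Ordinal sL))//= lerDl; apply: sumr_ge0 => l _.
  by have [] := HC l.
have /choice[Q HQ] := fun i => aT i (d i) (rd i).
exists Q; split.
- by move=> i; have [] := HQ i.
- move=> i; have [_ h _] := HQ i; apply: le_trans h _.
  by rewrite -[4 ^+ D * _ * _]mulrA [C' * _]mulrC.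
rewrite /jet_restr; apply: jet_eq_vanish.
- exact: smooth0_sphere_restr.
- by move=> i; rewrite on_sphere_taylor_poly; exact: smooth0_on_sphere.
move=> i; have [_ _] := HQ i; rewrite /same_jet.
have E := on_sphere_taylor_poly x z i.
suff -> : on_sphere (Q i - taylor_poly x z i) =
  (fun y => radial_ext (sphere_restr Q) y 0 i -
     radial_ext (fun s : sphere R n => taylor z (val s - val x)) y 0 i) by [].
apply/funext => y; have := congr1 (fun h => h y) E => /= ->.
by rewrite /on_sphere mevalB /radial_ext /sphere_restr mxE.
Qed.

End JetInterpolation.

(** * Norms and the stable neighborhood *)

Section NormEquivalence.
Context {R : realType}.

Section Basics.
Context {V : lmodType R} (nu : V -> R) (nu_norm : is_norm nu).

Lemma is_normZ a z : nu (a *: z) = `|a| * nu z.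
Proof. by have [_ h _] := nu_norm. Qed.

Lemma is_norm0 : nu 0 = 0.
Proof. by rewrite -(scale0r 0) is_normZ normr0 mul0r. Qed.

Lemma is_normN z : nu (- z) = nu z.
Proof. by rewrite -scaleN1r is_normZ normrN1 mul1r. Qed.

Lemma is_norm_ge0 z : 0 <= nu z.
Proof.
have [h _ _] := nu_norm; have := h z (- z).
by rewrite subrr is_norm0 is_normN; lra.
Qed.

Lemma is_norm_sum (I : Type) (s : seq I) (F : I -> V) :
  nu (\sum_(i <- s) F i) <= \sum_(i <- s) nu (F i).
Proof.
elim: s => [|i s IH]; first by rewrite !big_nil is_norm0.
have [h _ _] := nu_norm; rewrite !big_cons.
by apply: le_trans (h _ _) _; rewrite lerD2l.
Qed.

End Basics.

Lemma is_norm_continuous N (nu : 'rV[R]_N -> R) : is_norm nu -> continuous nu.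
Proof.
move=> nu_norm.
pose K := \sum_i nu (delta_mx 0 i) + 1.
have K0 : 0 < K by rewrite ltr_wpDl// sumr_ge0// => i _; exact: is_norm_ge0.
have nuK v : nu v <= `|v| * K.
  rewrite {1}(row_sum_delta v); apply: le_trans (is_norm_sum nu_norm _ _) _.
  rewrite mulrDr mulr1 ler_wpDr// mulr_sumr; apply: ler_sum => i _.
  by rewrite is_normZ// ler_wpM2r ?is_norm_ge0// normr_mx_coord_le.
have lip v w : `|nu v - nu w| <= `|v - w| * K.
  have [h _ _] := nu_norm.
  have h1 := h (v - w) w; have h2 := h (w - v) v; rewrite !subrK in h1 h2.
  have := nuK (v - w); have := nuK (w - v); rewrite (distrC w) => k1 k2.
  by rewrite ler_norml; apply/andP; split; lra.
move=> v; apply/(@cvgrPdist_lt _ _ _ (nbhs v)) => e e0.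
have d0 : 0 < e / K by rewrite divr_gt0.
apply/nbhs_ballP; exists (e / K) => //= w; rewrite -ball_normE /= => vw.
by apply: le_lt_trans (lip v w) _; rewrite -ltr_pdivlMr.
Qed.

(** The continuous function [nu] attains a minimum on the compact unit sphere of the sup norm, and
    it is positive by definiteness. *)
Lemma is_norm_rV_bound N (nu : 'rV[R]_N -> R) : is_norm nu ->
  exists2 c, 0 < c & forall v, `|v| <= c * nu v.
Proof.
move=> nu_norm; pose A : set 'rV[R]_N := [set v | `|v| = 1].
(* For [N = 0] the unit sphere is empty and there is no minimum to take. *)
have [A0|An0] := eqVneq A set0.
  exists 1 => // v; have [->|v0] := eqVneq v 0.
    by rewrite normr0 mul1r is_norm_ge0.
  have : A (`|v|^-1 *: v).
    by rewrite /A /= normrZ normfV normr_id mulVf// normr_eq0.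
  by rewrite A0.
have [c cA cmin] : exists2 c, c \in A & forall t, t \in A -> nu c <= nu t.
  apply: EVT_min_rV; first exact/set0P.
    apply: bounded_closed_compact.
      exists 1; split; first exact: real1.
      by move=> M M1 v /= ->; exact: ltW.
    have -> : A = Num.norm @^-1` [set 1] by [].
    apply: closed_comp; last exact: closed_eq.
    by move=> v _; exact: norm_continuous.
  by apply: continuous_subspaceT => v; exact: is_norm_continuous.
have c0 : 0 < nu c.
  rewrite lt_neqAle is_norm_ge0// andbT eq_sym; apply/eqP.
  have [_ _ h] := nu_norm; move=> /h c0; move: cA; rewrite inE /A /= c0 normr0.
  by move/esym/eqP; rewrite oner_eq0.
exists (nu c)^-1; first by rewrite invr_gt0.
move=> v; have [->|v0] := eqVneq v 0.
  by rewrite normr0 is_norm0 // mulr0.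
rewrite ler_pdivlMl// mulrC -ler_pdivlMl ?normr_gt0//.
have -> : `|v|^-1 * nu v = nu (`|v|^-1 *: v).
  by rewrite is_normZ// normfV normr_id.
apply: cmin; rewrite inE /A /= normrZ normfV normr_id mulVf// normr_eq0.
by [].
Qed.

Lemma is_norm_mx_bound p q (nu : 'M[R]_(p, q) -> R) : is_norm nu ->
  exists2 c, 0 < c & forall z, `|z| <= c * nu z.
Proof.
move=> nu_norm; have [hD hZ h0] := nu_norm.
have nvec : is_norm (fun v => nu (vec_mx v)).
  split=> [z w|a z|z /h0 z0]; first by rewrite linearD hD.
    by rewrite linearZ hZ.
  by rewrite -[z]vec_mxK z0 linear0.
have [c c0 hc] := is_norm_rV_bound nvec; exists c => // z.
have := hc (mxvec z); rewrite mxvecK; apply: le_trans.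
rewrite [leLHS]/Num.Def.normr/= mx_normrE bigmax_le ?normr_ge0//= => -[i j] _.
by rewrite -mxvecE normr_mx_coord_le.
Qed.

End NormEquivalence.

Section BombieriWeyl.
Context {R : realType} {n m : nat}.

Lemma sum_bw_coef_sqr d (p : mpoly n.+1 R) : p \is ishomog1 d mdeg ->
  \sum_(a : mpoly.bmultinom n.+1 d.+1 | mdeg a == d) bw_coef d p a ^+ 2 =
  fischer p p / d`!%:R.
Proof.
move=> hp.
pose s := [seq (val a : multinom n.+1) | a <- enum {: mpoly.bmultinom n.+1 d.+1} & mdeg (val a) == d].
have us : uniq s.
  rewrite map_inj_uniq => [|a b /val_inj//].
  by apply: filter_uniq; exact: enum_uniq.
rewrite (@fischer_big _ _ s)//; last first.
  move=> a ap; have ad : mdeg a = d := dhomogP _ _ _ hp a ap.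
  have ad1 : (mdeg a < d.+1)%N by rewrite ad.
  apply/mapP; exists (mpoly.BMultinom ad1) => //.
  by rewrite mem_filter /= ad eqxx mem_enum.
rewrite big_map big_filter big_enum_cond mulr_suml; apply: eq_bigr => a /= _.
rewrite /bw_coef expr_div_n sqr_sqrtr; last by rewrite divr_ge0.
by rewrite invf_div /mnm_fact; ring.
Qed.

Lemma bw_norm_le (d : 'I_m -> nat) (Q : 'I_m -> mpoly n.+1 R) (A : R) :
  hpoly_sys R n m d Q -> 0 <= A ->
  (forall i, fischer (Q i) (Q i) <= A * (d i)`!%:R) ->
  bw_norm d Q <= Num.sqrt (m%:R * A).
Proof.
move=> hQ A0 hA; rewrite /bw_norm ler_sqrt ?mulr_ge0//.
under eq_bigr do rewrite sum_bw_coef_sqr ?hQ//.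
apply: (@le_trans _ _ (\sum_(i < m) A)).
  by apply: ler_sum => i _; rewrite ler_pdivrMr ?ltr0n ?fact_gt0.
by rewrite sumr_const card_ord mulr_natl.
Qed.

End BombieriWeyl.

Section StableNeighborhood.
Context {R : realType} {n m r : nat}.
Implicit Types f g : sphere R n -> 'rV[R]_m.

Lemma taylorZ N k c (z : jet_fiber R N m k) v :
  taylor (c *: z) v = c *: taylor z v.
Proof.
rewrite /taylor scaler_sumr; apply: eq_bigr => a _.
by rewrite [row a (c *: z)]linearZ !scalerA mulrC.
Qed.

Lemma Ck_sphere_taylor k (x : sphere R n) (z : jet_fiber R n.+1 m r.+1) :
  Ck_sphere k (fun s : sphere R n => taylor z (val s - val x)).
Proof.
apply: Ck_sphere_smooth => i; rewrite on_sphere_taylor_poly.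
exact: smooth0_on_sphere.
Qed.

Lemma Ck_sphereD k f g c : Ck_sphere k f -> Ck_sphere k g ->
  Ck_sphere k (f + c *: g).
Proof.
move=> fk gk; rewrite /Ck_sphere -[radial_ext _]/(radial_ext f + c *: radial_ext g).
exact: Ck_onD open_punctured fk (Ck_onZ c open_punctured gk).
Qed.

Lemma Ck_sphere_restr k (Q : 'I_m -> mpoly n.+1 R) : Ck_sphere k (sphere_restr Q).
Proof. by apply: Ck_sphere_smooth => i; exact: smooth0_sphere_restr. Qed.

Lemma jet_restrZ c x (z : jet_fiber R n.+1 m r.+1) g : Ck_sphere r.+1 g ->
  jet_restr x z = jet r.+1 g x -> jet_restr x (c *: z) = jet r.+1 (c *: g) x.
Proof.
move=> gk E; have z0 : Ck_sphere r.+1 (0 : sphere R n -> 'rV[R]_m).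
  by apply: Ck_on_cst; exact: open_punctured.
have := jetD_eq c z0 z0 (Ck_sphere_taylor _ x z) gk erefl E.
rewrite !add0r => <-; rewrite /jet_restr; congr (jet _ _ _).
by apply/funext => s; rewrite taylorZ.
Qed.

(** Jet and differential are made parameters, the latter as a plain function, so that both
    equalities of [transversal_at_jet] can be substituted at once. *)
Definition transversal_at (Z : set (jet_ambient R n m r)) (x : sphere R n)
    (w : jet_ambient R n m r) (D : 'rV[R]_n.+1 -> jet_ambient R n m r) : Prop :=
  ~ Z w \/
  Z w /\
  [set u + v | u in D @` tangent [set y | enorm y = 1] (val x)
     & v in tangent Z w] = tangent (jet_space R n m r) w.

Lemma not_transversal_jet k (S : 'I_k -> set (jet_ambient R n m r)) f :
  Ck_sphere r.+1 f -> ~ transversal f S ->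
  exists x, forall g, Ck_sphere r.+1 g ->
    jet r.+1 f x = jet r.+1 g x -> ~ transversal g S.
Proof.
move=> fk; have fE : transversal f S = forall i x, transversal_at (S i) x (jet r f x)
  ('d (radial_ext (jet r f)) (val x)) by [].
rewrite fE => /existsNP[i /existsNP[x nT]].
exists x => g gk E Tg; apply: nT; have [jE dE] := transversal_at_jet fk gk E.
exact: (eq_ind_r id (Tg i x) (f_equal2 (transversal_at (S i) x) jE dE)).
Qed.

End StableNeighborhood.

Theorem theorem7 (R : realType) (n m r : nat)
  (nu : jet_fiber R n.+1 m r.+1 -> R)
  (nu_norm : is_norm nu)
  (nu_inv : forall g : 'M[R]_n.+1, orthogonal_mx g ->
              forall z, nu (fiber_act g z) = nu z)
  (W : set (jet_ambient R n m r))
  (W_sing : singularity_type W)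
  (k : nat) (S : 'I_k -> set (jet_ambient R n m r))
  (S_strat : smooth_stratification W S) :
  exists c1 : R, 0 < c1 /\
    forall (d : 'I_m -> nat), (forall i, (r.+1 <= d i)%N) ->
    forall P : 'I_m -> mpoly n.+1 R,
      hpoly_sys R n m d P -> ~ discriminant S d P ->
      [set f : sphere R n -> 'rV[R]_m |
         Ck_sphere r.+1 f /\
         (Ck_norm nu (f \- sphere_restr P)%R
            < c1%:E * bw_dist d P (discriminant S d))%E]
      `<=` stable_nbhd nu (sphere_restr P) S.
Proof.
have [C C0 hC] := @jet_interpolation R n m r.
have [c c0 hc] := @is_norm_mx_bound R _ _ nu nu_norm.
(* The square root comes from [bw_norm_le], the factor [c] from comparing the sup norm with [nu];
   the [+ 1] makes [K] positive even if the product is 0. *)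
pose K := Num.sqrt (m%:R * C) * c + 1.
have K0 : 0 < K by rewrite ltr_wpDl// mulr_ge0 ?sqrtr_ge0 ?ltW.
exists K^-1; split; first by rewrite invr_gt0.
move=> d rd P hP _ f [fk fnorm].
set p := sphere_restr P; pose phi := f - p.
have pk : Ck_sphere r.+1 p := Ck_sphere_restr _ _.
have phik : Ck_sphere r.+1 phi.
  by rewrite /phi -scaleN1r; exact: Ck_sphereD.
have fnorm' : (Ck_norm nu phi < K^-1%:E * bw_dist d P (discriminant S d))%E by [].
pose h (t : R) := p + t *: phi.
have hk t : Ck_sphere r.+1 (h t) by exact: Ck_sphereD.
(* The quotient norm is an infimum that need not be attained, but a strict bound on it passes to
   some lift. [M] is extended real because the distance is [+oo] when the discriminant is empty. *)
have phi_lift x (M : \bar R) : (Ck_norm nu phi < M)%E ->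
    exists z, jet_restr x z = jet r.+1 phi x /\ ((nu z)%:E < M)%E.
  move=> pM; have : (quotient_norm nu x (jet r.+1 phi x) < M)%E.
    by apply: le_lt_trans pM; apply: ereal_sup_ubound; exists x.
  by move=> /ereal_inf_lt[_ [z zE <-] zM]; exists z.
(* Continuity of the homotopy calls for a finite bound. *)
have [M [M0 phiM]] : exists M : R, 0 < M /\ (Ck_norm nu phi < M%:E)%E.
  have : (Ck_norm nu phi < +oo)%E by apply: lt_le_trans fnorm' _; exact: leey.
  case: (Ck_norm nu phi) => [a _||_] //.
    exists (`|a| + 1); split; first by rewrite ltr_wpDl.
    by rewrite lte_fin (le_lt_trans (ler_norm a))// ltrDl.
  by exists 1; split => //; exact: ltNyr.
split => //; exists h; split.
- by rewrite /h scale0r addr0.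
- by rewrite /h scale1r addrC subrK.
- by move=> t _; exact: hk.
(* Since [h s - h t = (s - t) *: phi], this radius keeps every quotient norm at most [e / 2]; the
   supremum over the sphere is then still strictly below [e]. *)
- move=> t _ e e0; have d0 : 0 < e / (2 * M) by rewrite divr_gt0 ?mulr_gt0.
  apply/nbhs_ballP; exists (e / (2 * M)) => //= s; rewrite -ball_normE /= => st _.
  have -> : (h s \- h t)%R = (s - t) *: phi.
    by rewrite -[LHS]/(h s - h t) /h addrAC opprD addrA subrr add0r addrC -scalerBl.
  apply: (@le_lt_trans _ _ (e / 2)%:E); last by rewrite lte_fin ltr_pdivrMr// ltr_pMr// ltr1n.
  apply: ge_ereal_sup => _ [x _ <-].
  have [z [zE zM]] := phi_lift x _ phiM.
  apply: ge_ereal_inf; exists (nu ((s - t) *: z))%:E.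
    by exists ((s - t) *: z) => //; exact: jet_restrZ.
  rewrite lee_fin is_normZ//; move: st; rewrite distrC => /ltW st.
  apply: (@le_trans _ _ (e / (2 * M) * M)).
    by apply: ler_pM => //; [exact: is_norm_ge0|exact: ltW].
  by rewrite invfM mulrA divfK ?gt_eqF.
move=> t /andP[t0 t1]; apply: contrapT => nT.
have [x nTx] := not_transversal_jet (hk t) nT.
have [z [zE zd]] := phi_lift x _ fnorm'.
have [Q [hQ bQ jQ]] := hC x z d rd.
(* Its restriction has the [r.+1]-jet of [h t] at [x], so it fails to be transversal as well. Its
   distance to [P] is [t] times the norm of [Q], with [t <= 1]. *)
pose P' i := P i + t *: Q i.
have P'E : sphere_restr P' = p + t *: sphere_restr Q.
  by apply/funext => y; apply/rowP => i; rewrite !mxE mevalD mevalZ.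
have P'disc : discriminant S d P'.
  split; first by move=> i; apply: dhomogD; [exact: hP|exact/dhomogZ/hQ].
  apply: nTx; first exact: Ck_sphere_restr.
  rewrite P'E; apply: jetD_eq => //; first exact: Ck_sphere_restr.
  by rewrite jQ zE.
have bw_le : bw_norm d (fun i => P i - P' i) <= K * nu z.
  have -> : (fun i => P i - P' i) = (fun i => - t *: Q i).
    by apply/funext => i; rewrite /P' opprD addNKr scaleNr.
  have hA : 0 <= C * `|z| ^+ 2 by rewrite mulr_ge0 ?sqr_ge0.
  apply: le_trans (bw_norm_le (A := C * `|z| ^+ 2) _ hA _) _.
  - by move=> i; apply/dhomogZ/hQ.
  - move=> i; rewrite fischerZl fischerZr mulrA mulrNN -expr2.
    apply: le_trans (bQ i); rewrite ler_piMl ?fischer_ge0//.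
    by rewrite expr_le1.
  rewrite mulrA sqrtrM ?mulr_ge0// sqrtr_sqr normr_id.
  rewrite /K mulrDl mul1r ler_wpDr ?is_norm_ge0// -mulrA.
  by rewrite ler_wpM2l ?sqrtr_ge0.
have dist_le : (bw_dist d P (discriminant S d) <= (K * nu z)%:E)%E.
  apply: ge_ereal_inf; exists (bw_norm d (fun i => P i - P' i))%:E; last by rewrite lee_fin.
  by exists P'.
(* This contradicts the choice of [z], whose norm lies strictly below the same quantity. *)
have : (K^-1%:E * bw_dist d P (discriminant S d) <= (nu z)%:E)%E.
  apply: (@le_trans _ _ (K^-1%:E * (K * nu z)%:E)%E).
    by apply: lee_wpmul2l => //; rewrite lee_fin invr_ge0 ltW.
  by rewrite -EFinM mulKf ?gt_eqF.
by rewrite leNgt zd.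
Qed.
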